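(* Let $n\geq 1$ be an integer. Then \[ \int_0^\infty \frac{\sinh((2n-1)x)}{x\cosh^{2n+1}x}\,dx = \sum_{p=1}^{n}(2^{2p+1}-1)\,\Bigl([z^{2n}]\,U_{2n-2}(z)(\arcsin z)^{2p}\Bigr)\,\frac{\zeta(2p+1)}{\pi^{2p}}, \] and \[ \int_0^\infty \frac{\sinh((2n-1)x)}{x\cosh^{2n}x}\,dx = \sum_{p=1}^{n}2^{2p}\,\Bigl([z^{2n-1}]\,U_{2n-2}(z)(\arcsin z)^{2p-1}\Bigr)\,\frac{\beta(2p)}{\pi^{2p-1}}. \] Moreover, for every integer $p$ with $1\leq p\leq n$, \[ (-1)^{p-1}[z^{2n}]\,U_{2n-2}(z)(\arcsin z)^{2p}>0 \quad\text{and}\quad (-1)^{p-1}[z^{2n-1}]\,U_{2n-2}(z)(\arcsin z)^{2p-1}>0 . \] Hence the summands (indexed by $p=1,\dots,n$) on the right-hand sides of both integral representations alternate strictly in sign, beginning with a positive term.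
   Context: $\zeta$ is the Riemann zeta function and $\beta(s)=\sum_{j=0}^\infty \frac{(-1)^j}{(2j+1)^s}$ is the Dirichlet beta function. $U_m$ is the Chebyshev polynomial of the second kind, normalized by $U_m(\cos\theta)=\frac{\sin((m+1)\theta)}{\sin\theta}$. For a power series or Laurent series $F$, $[z^r]F(z)$ denotes the coefficient of $z^r$ in the expansion of $F$ at the origin; $\arcsin z$ is expanded as its Taylor series at $0$ (with $\arcsin 0=0$). *)

(* Defs.v *)
From HB Require Import structures.
From mathcomp Require Import all_boot all_order all_algebra.
From mathcomp Require Import all_classical all_reals all_analysis.
From mathcomp Require Import ring.

Set Implicit Arguments.
Unset Strict Implicit.
Unset Printing Implicit Defensive.

Import Order.TTheory GRing.Theory Num.Theory.
Import numFieldNormedType.Exports.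

Local Open Scope classical_set_scope.
Local Open Scope ring_scope.

Definition sinh {R : realType} (x : R) : R := (expR x - expR (- x)) / 2.
Definition cosh {R : realType} (x : R) : R := (expR x + expR (- x)) / 2.

(* Only meaningful for 1 < s, where the Dirichlet series converges and equals
   the Riemann zeta function; [limn] is unspecified elsewhere. *)
Definition zeta {R : realType} (s : R) : R :=
  limn (series (fun j : nat => (j.+1%:R `^ s)^-1)).

(* Only meaningful for 0 < s, where the series converges. *)
Definition dirichlet_beta {R : realType} (s : R) : R :=
  limn (series (fun j : nat => (-1) ^+ j / (2 * j + 1)%:R `^ s)).

(* The pair (U_m, U_{m+1}) of Chebyshev polynomials of the second kind, from
   U_0 = 1, U_1 = 2X and U_{m+2} = 2X U_{m+1} - U_m. *)
Fixpoint chebyshevU_pair (R : realType) (m : nat) : {poly R} * {poly R} :=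
  if m is k.+1 then
    let: (u, v) := chebyshevU_pair R k in (v, 'X *+ 2 * v - u)
  else (1, 'X *+ 2).

Definition chebyshevU (R : realType) (m : nat) : {poly R} :=
  (chebyshevU_pair R m).1.

Lemma chebyshevU_pairE (R : realType) (m : nat) :
  chebyshevU_pair R m = (chebyshevU R m, chebyshevU R m.+1).
Proof. by rewrite /chebyshevU /=; case: chebyshevU_pair. Qed.

Lemma chebyshevU_rec (R : realType) (m : nat) :
  chebyshevU R m.+2 = 'X *+ 2 * chebyshevU R m.+1 - chebyshevU R m.
Proof. by rewrite {1}/chebyshevU /= chebyshevU_pairE. Qed.

(* The defining normalization U_m(cos t) = sin((m+1)t) / sin t; it determines
   U_m, since cos takes infinitely many values where sin does not vanish. *)
Lemma chebyshevU_cos (R : realType) (m : nat) (t : R) : sin t != 0 ->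
  (chebyshevU R m).[cos t] = sin (m.+1%:R * t) / sin t.
Proof.
move=> t0.
suff [] : (chebyshevU R m).[cos t] * sin t = sin (m.+1%:R * t) /\
          (chebyshevU R m.+1).[cos t] * sin t = sin (m.+2%:R * t).
  by move=> <- _; rewrite mulfK.
elim: m => [|m [IH1 IH2]].
  rewrite /chebyshevU /= !hornerE; split=> //.
  have -> : 2%:R * t = t + t by ring.
  by rewrite sinD; ring.
split=> //; rewrite chebyshevU_rec !hornerE mulrBl -mulrA IH2 IH1.
have -> : m.+3%:R * t = m.+2%:R * t + t by rewrite -[in LHS]natr1; ring.
have -> : m.+1%:R * t = m.+2%:R * t - t by rewrite -[in RHS]natr1; ring.
by rewrite sinB sinD; ring.
Qed.

(* [z^r] f(z) for f analytic at the origin, as the Taylor coefficient. *)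
Definition coef_at0 {R : realType} (r : nat) (f : R -> R) : R :=
  derive1n r f 0 / r`!%:R.

(* [z^r] of U_{2n-2}(z) (arcsin z)^k; all natural-number subtractions below are
   used with 1 <= p <= n only, so truncation plays no role. *)
Definition coefUasin (R : realType) (n r k : nat) : R :=
  coef_at0 r (fun z : R => (chebyshevU R (2 * n - 2)).[z] * asin z ^+ k).

Definition alternates_from_pos {R : realType} (n : nat) (t : nat -> R) : Prop :=
  0 < t 1%N /\ (forall p : nat, (1 <= p < n)%N -> t p * t p.+1 < 0).

Definition zeta_summand (R : realType) (n p : nat) : R :=
  (2 ^+ (2 * p + 1) - 1) * coefUasin R n (2 * n) (2 * p)
  * (zeta (2 * p + 1)%:R / pi ^+ (2 * p)).

Definition beta_summand (R : realType) (n p : nat) : R :=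
  2 ^+ (2 * p) * coefUasin R n (2 * n - 1) (2 * p - 1)
  * (dirichlet_beta (2 * p)%:R / pi ^+ (2 * p - 1)).

(* Main.v *)
Require Import Defs.
From HB Require Import structures.
From mathcomp Require Import all_boot all_order all_algebra.
From mathcomp Require Import all_classical all_reals all_analysis.
From mathcomp Require Import ring lra zify.

Set Implicit Arguments.
Unset Strict Implicit.
Unset Printing Implicit Defensive.

Import Order.TTheory GRing.Theory Num.Theory.
Import numFieldNormedType.Exports.

Local Open Scope classical_set_scope.
Local Open Scope ring_scope.

(** Writing [z = sin s], the kernel [sinh x / (cosh x - cos v)] at [v = pi/2 - s]
    is the generating function of the functions [sinh x / cosh^(m+1) x] in the
    variable [z].  Iterating the duplication formula
    [K(x, v) = (K(x/2, v/2) + K(x/2, v/2 + pi)) / 2] gives its partial fractions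
    in [x], whose integrals against [dx / x] are elementary; expanding these in
    powers of [s] produces the odd zeta and even beta values.  Comparing both
    expansions of the integral up to [O(z^(r+1))], after multiplication by
    [U_(2n-2)(z)], gives the two formulas.  The signs come from
    [U_(2n-2)(z) = cos(N w + const) / cos w], [w = arcsin z], [N = 2n-1], whose
    product with [w^k] satisfies a second order differential equation: its
    Taylor coefficients are, up to factorials and a sign, the coefficients of
    products of [(X + N)^2 - j^2] with [j <= N]. *)

(** * Taylor coefficients of functions of arcsin *)

(** Why [U_(2n-2)] appears: [sinh ((2n-1) x) = U_(2n-2)(cosh x) sinh x], so each integrand is a
    combination of the functions [sinh x / (x cosh^(m+1) x)]. With [tau m] their integrals, the
    integral sought is the coefficient of [z^r] in [U_(2n-2)(z)] times the sum of the [tau m z^m],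
    for [r = 2n] or [r = 2n-1]; no single [tau m] is ever evaluated. The obstacle is that
    [kern x v / x] decays only like [1/x]. Only its difference with the value at [v = pi/2], that is
    at [z = 0], gets integrated. This loses the term [m = 0], which is never called for because
    [deg U_(2n-2) < r]. No infinite series in [z] or [s] is summed: for a fixed small [s > 0], both
    expansions of one integral are truncated with explicit remainders, and letting [s] tend to 0
    identifies coefficients of polynomials. Duplication likewise replaces complex analysis: at scale
    [2^-N] each of the [2^N] terms is within [C x / 2^N] of its two nearest poles, and averaging
    keeps that bound. The expansion in [s] mixes zeta and beta values; the parity of
    [U_(2n-2)(z) (arcsin z)^l] separates them. *)

(* A syntax closed under formal differentiation; it makes every function that
   it denotes smooth on (-1, 1). *)
Inductive asin_expr (R : realType) : Type :=
| AVar | AInvCos | AAsin | ACst of R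
| ACos of R & R
| AAdd of asin_expr R & asin_expr R
| AMul of asin_expr R & asin_expr R.
Arguments AVar {R}.
Arguments AInvCos {R}.
Arguments AAsin {R}.

Fixpoint aeval (R : realType) (e : asin_expr R) (z : R) : R :=
  match e with
  | AVar => z
  | AInvCos => (cos (asin z))^-1
  | AAsin => asin z
  | ACst c => c
  | ACos a b => cos (a * asin z + b)
  | AAdd e1 e2 => aeval e1 z + aeval e2 z
  | AMul e1 e2 => aeval e1 z * aeval e2 z
  end.

(** The quarter turn in the [ACos] case spares a constructor for the sine, and lets phases keep
    track of signs. *)
Fixpoint aderiv (R : realType) (e : asin_expr R) : asin_expr R :=
  match e with
  | AVar => ACst 1
  | AInvCos => AMul AVar (AMul AInvCos (AMul AInvCos AInvCos))
  | AAsin => AInvCos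
  | ACst _ => ACst 0
  | ACos a b => AMul (AMul (ACst a) (ACos a (b + pi / 2))) AInvCos
  | AAdd e1 e2 => AAdd (aderiv e1) (aderiv e2)
  | AMul e1 e2 => AAdd (AMul (aderiv e1) e2) (AMul e1 (aderiv e2))
  end.

Lemma cos_asin_gt0 (R : realType) (z : R) : -1 < z < 1 -> 0 < cos (asin z).
Proof.
move=> /andP[z1 z2]; apply: cos_gt0_pihalf.
by rewrite asin_gtNpi2 ?asin_ltpi2// ?z1 ?z2 ltW.
Qed.

Lemma is_derive_asin_cos (R : realType) (z : R) : -1 < z < 1 ->
  is_derive z 1 (@asin R) (cos (asin z))^-1.
Proof.
move=> z1; rewrite cos_asin; first exact: is_derive1_asin.
by case/andP: z1 => *; rewrite !ltW.
Qed.

Lemma is_derive_aeval (R : realType) (e : asin_expr R) (z : R) : -1 < z < 1 ->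
  is_derive z 1 (aeval e) (aeval (aderiv e) z).
Proof.
move=> z1; have dasin := is_derive_asin_cos z1.
have c0 := cos_asin_gt0 z1.
have z1' : z \in `[(-1), 1] by case/andP: z1 => *; rewrite in_itv/= !ltW.
elim: e => [||||a b|e1 IH1 e2 IH2|e1 IH1 e2 IH2] /=.
- exact: is_derive_id.
- have dc := @is_derive1_comp R (@cos R) (@asin R) z _ _ (is_derive_cos _) dasin.
  have cn0 : (cos \o asin) z != 0 by rewrite /= lt0r_neq0.
  apply: (is_derive_eq (is_deriveV cn0 dc)).
  rewrite /= asinK//= /GRing.scale/=.
  by field; rewrite lt0r_neq0.
- exact: dasin.
- by move=> c; exact: is_derive_cst.
- have dl : is_derive z 1 (fun z => a * asin z + b) (a * (cos (asin z))^-1).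
    have dm := @is_deriveM _ _ (cst a) _ z 1 _ _ (is_derive_cst _ _ _) dasin.
    apply: (is_derive_eq (is_deriveD dm (is_derive_cst b z 1))).
    by rewrite scaler0 !addr0.
  have dc := @is_derive1_comp R (@cos R) _ z _ _ (is_derive_cos _) dl.
  apply: (is_derive_eq dc).
  by rewrite addrA cosD cos_pihalf sin_pihalf /=; ring.
- exact: is_deriveD.
- apply: (is_derive_eq (is_deriveM IH1 IH2)).
  by rewrite /= /GRing.scale/=; ring.
Qed.

Lemma near_itvN11 (R : realType) (P : R -> Prop) (z : R) : -1 < z < 1 ->
  (forall y, -1 < y < 1 -> P y) -> \forall y \near z, P y.
Proof.
move=> z1 H; have /near_in_itvoo : z \in `](-1), 1[ by rewrite in_itv.
by apply: filterS => y; rewrite in_itv/=; exact: H.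
Qed.

(** [aderiv] computes the true derivative on an open interval, so it respects equality of values and
    not only of syntax. An identity checked by [ring] on values can thus be differentiated again. *)
Lemma eq_aeval_aderiv (R : realType) (e1 e2 : asin_expr R) :
  (forall z, -1 < z < 1 -> aeval e1 z = aeval e2 z) ->
  forall z, -1 < z < 1 -> aeval (aderiv e1) z = aeval (aderiv e2) z.
Proof.
move=> e12 z z1.
have d1 := is_derive_aeval e1 z1; have d2 := is_derive_aeval e2 z1.
rewrite -(@derive_val _ _ _ _ _ _ _ d1) -(@derive_val _ _ _ _ _ _ _ d2).
by apply: near_eq_derive; exact: (near_itvN11 z1).
Qed.

Lemma derive1n_aeval (R : realType) (f : R -> R) (e : asin_expr R) (r : nat) :
  (forall z, -1 < z < 1 -> f z = aeval e z) ->
  forall z, -1 < z < 1 -> derive1n r f z = aeval (iter r (@aderiv R) e) z.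
Proof.
move=> fe; elim: r => [//|r IH] z z1.
rewrite derive1nS derive1E iterS.
have d1 := is_derive_aeval (iter r (@aderiv R) e) z1.
rewrite -(@derive_val _ _ _ _ _ _ _ d1).
by apply: near_eq_derive; exact: (near_itvN11 z1).
Qed.

Lemma aderivD (R : realType) (e1 e2 : asin_expr R) (r : nat) :
  iter r (@aderiv R) (AAdd e1 e2) =
  AAdd (iter r (@aderiv R) e1) (iter r (@aderiv R) e2).
Proof. by elim: r => //= r ->. Qed.

Lemma aderivZ (R : realType) (c : R) (e : asin_expr R) (r : nat) (z : R) :
  -1 < z < 1 -> aeval (iter r (@aderiv R) (AMul (ACst c) e)) z =
  c * aeval (iter r (@aderiv R) e) z.
Proof.
elim: r z => [//|r IH] z z1.
rewrite !iterS (@eq_aeval_aderiv R _ (AMul (ACst c) (iter r (@aderiv R) e)))//=.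
by rewrite mul0r add0r.
Qed.

Lemma invcos_asin_sqr (R : realType) (z : R) : -1 < z < 1 ->
  (1 - z ^+ 2) * (cos (asin z))^-1 ^+ 2 = 1.
Proof.
move=> z1; have c0 := cos_asin_gt0 z1.
have <- : cos (asin z) ^+ 2 = 1 - z ^+ 2.
  by rewrite cos2sin2 asinK//; case/andP: z1 => *; rewrite in_itv/= !ltW.
by rewrite -exprMn divff ?expr1n// lt0r_neq0.
Qed.

(* For f(z) = g(arcsin z) / sqrt(1 - z^2), with g1 and g2 the first two
   derivatives of g along arcsin. *)
Lemma asin_ode (R : realType) (g g1 g2 : asin_expr R) :
  (forall z, -1 < z < 1 -> aeval (aderiv g) z = (cos (asin z))^-1 * aeval g1 z) ->
  (forall z, -1 < z < 1 -> aeval (aderiv g1) z = (cos (asin z))^-1 * aeval g2 z) ->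
  forall z, -1 < z < 1 ->
  (1 - z ^+ 2) * aeval (iter 2 (@aderiv R) (AMul g AInvCos)) z =
  3 * z * aeval (aderiv (AMul g AInvCos)) z + aeval (AMul g AInvCos) z +
  aeval (AMul g2 AInvCos) z.
Proof.
move=> gg1 gg2 z z1.
pose H : asin_expr R := AInvCos.
pose F := AAdd (AMul H (AMul g1 H)) (AMul g (AMul AVar (AMul H (AMul H H)))).
have fF y : -1 < y < 1 -> aeval (aderiv (AMul g AInvCos)) y = aeval F y.
  by move=> y1 /=; rewrite gg1//; ring.
rewrite fF// 2!iterS [iter 0 _ _]/=.
rewrite (eq_aeval_aderiv fF)//= gg1// gg2//.
have h2 := invcos_asin_sqr z1.
move: h2; set h := (cos _)^-1 => h2.
apply/eqP; rewrite -subr_eq0; apply/eqP.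
pose G0 := aeval g z; pose G1 := aeval g1 z; pose G2 := aeval g2 z.
rewrite -/G0 -/G1 -/G2.
(* The difference of the two sides is a multiple of the relation [(1 - z^2) h^2 = 1]; the long
   factor is the cofactor. *)
transitivity (((1 - z ^+ 2) * h ^+ 2 - 1) *
   (h * G2 + 3 * z * h ^+ 2 * G1 + G0 * h + 3 * z ^+ 2 * h ^+ 3 * G0)); first by ring.
by rewrite h2 subrr mul0r.
Qed.

(** Each differentiation adds [2z] to the coefficient of the middle term and moves [2r + 3] into
    that of the last one, which keeps it a square. At [z = 0] the middle term vanishes and a
    recurrence of step two remains. *)
Lemma asin_ode_deriv (R : realType) (f q : asin_expr R) (r : nat) :
  (forall z, -1 < z < 1 -> (1 - z ^+ 2) * aeval (iter 2 (@aderiv R) f) z =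
     3 * z * aeval (aderiv f) z + aeval f z + aeval q z) ->
  forall z, -1 < z < 1 ->
  (1 - z ^+ 2) * aeval (iter r.+2 (@aderiv R) f) z =
  (2 * r + 3)%:R * z * aeval (iter r.+1 (@aderiv R) f) z +
  (r.+1)%:R ^+ 2 * aeval (iter r (@aderiv R) f) z + aeval (iter r (@aderiv R) q) z.
Proof.
move=> fq; elim: r => [|r IH] z z1; first by rewrite fq// expr1n mul1r.
pose F k := iter k (@aderiv R) f.
pose Q k := iter k (@aderiv R) q.
pose L := AMul (AAdd (ACst 1) (AMul (ACst (-1)) (AMul AVar AVar))) (F r.+2).
pose T := AAdd (AAdd (AMul (AMul (ACst (2 * r + 3)%:R) AVar) (F r.+1))
  (AMul (ACst (r.+1%:R ^+ 2)) (F r))) (Q r).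
have LT y : -1 < y < 1 -> aeval L y = aeval T y.
  by move=> y1; rewrite /= -IH//; ring.
have := eq_aeval_aderiv LT z1; rewrite /=.
rewrite -!iterS.
have -> : (2 * r.+1 + 3)%:R = 2 * r%:R + 5 :> R by rewrite natrD natrM -natr1; ring.
have -> : (2 * r + 3)%:R = 2 * r%:R + 3 :> R by rewrite natrD natrM; ring.
have -> : r.+2%:R = r%:R + 2 :> R by rewrite -addn2 natrD.
have -> : r.+1%:R = r%:R + 1 :> R by rewrite -natr1.

move: (aeval (iter r.+3 _ _) z) (aeval (iter r.+2 _ _) z) => A B.
move: (aeval (iter r.+1 _ f) z) (aeval (iter r.+1 _ q) z) (aeval (F r) z) => C E G.
by move=> h; lra.
Qed.

(** * Derivatives at 0 of [cos (a w + b) w^k / cos w], where [w = arcsin z] *)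

Definition APow (R : realType) (k : nat) : asin_expr R :=
  iter k (AMul AAsin) (ACst 1).

Definition ACosPow (R : realType) (a b : R) (k : nat) : asin_expr R :=
  AMul (ACos a b) (APow R k).

Lemma aeval_APow (R : realType) (k : nat) (z : R) : aeval (APow R k) z = asin z ^+ k.
Proof. by elim: k => //= k; rewrite exprS => <-. Qed.

Lemma aderiv_APow (R : realType) (k : nat) (z : R) :
  aeval (aderiv (APow R k)) z = (cos (asin z))^-1 * (k%:R * asin z ^+ k.-1).
Proof.
elim: k => [|k IH] /=; first by rewrite mul0r mulr0.
rewrite IH -/(APow R k) aeval_APow -natr1.
case: k {IH} => [|k] /=; first by ring.
by rewrite exprS; ring.
Qed.

(** [ACosPow1] and [ACosPow2] serve as [g1] and [g2] in [asin_ode]. Where [k.-1] or [k.-2]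
    truncates, the factor in front is zero. *)
Definition ACosPow1 (R : realType) (a b : R) (k : nat) : asin_expr R :=
  AAdd (AMul (ACst a) (ACosPow a (b + pi / 2) k))
       (AMul (ACst k%:R) (ACosPow a b k.-1)).

Definition ACosPow2 (R : realType) (a b : R) (k : nat) : asin_expr R :=
  AAdd (AAdd (AMul (ACst (a ^+ 2)) (ACosPow a (b + pi / 2 + pi / 2) k))
             (AMul (ACst (2 * a * k%:R)) (ACosPow a (b + pi / 2) k.-1)))
       (AMul (ACst (k%:R * k.-1%:R)) (ACosPow a b k.-2)).

Lemma aderiv_ACosPow (R : realType) (a b : R) (k : nat) (z : R) :
  aeval (aderiv (ACosPow a b k)) z =
  (cos (asin z))^-1 * aeval (ACosPow1 a b k) z.
Proof. by rewrite /= aderiv_APow !aeval_APow; ring. Qed.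

Lemma aderiv_ACosPow1 (R : realType) (a b : R) (k : nat) (z : R) :
  aeval (aderiv (ACosPow1 a b k)) z =
  (cos (asin z))^-1 * aeval (ACosPow2 a b k) z.
Proof.
by rewrite /= !aderiv_APow !aeval_APow; ring.
Qed.

(** Up to the factor [i^r], this is the [r]-th derivative at 0 of [exp (i (X + a) w) / cos w],
    [w = arcsin z], with a formal parameter [X]: the equation of [asin_ode] multiplies by
    [(r+1)^2 - (X + a)^2] in passing from [r] to [r+2]. The coefficient of [X^k] isolates the factor
    [w^k]. *)
Fixpoint asin_poly (R : realType) (a : R) (r : nat) : {poly R} :=
  match r with
  | 0 => 1
  | 1 => 'X + a%:P
  | (k.+1 as k').+1 => (('X + a%:P) ^+ 2 - (k.+1%:R ^+ 2)%:P) * asin_poly a k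
  end.

Lemma asin0 (R : realType) : asin (0 : R) = 0.
Proof.
rewrite -[in LHS]sin0 sinK// in_itv/= oppr_le0 andbb.
by rewrite divr_ge0// pi_ge0.
Qed.

Lemma asin_polySS (R : realType) (a : R) (r k : nat) :
  (asin_poly a r.+2)`_k = (if (k < 2)%N then 0 else (asin_poly a r)`_(k - 2)) +
    2 * a * (if k == 0%N then 0 else (asin_poly a r)`_k.-1) +
    (a ^+ 2 - r.+1%:R ^+ 2) * (asin_poly a r)`_k.
Proof.
rewrite [asin_poly _ _]/=.
rewrite (_ : _ * _ = 'X^2 * asin_poly a r + (a%:P * ('X * asin_poly a r)) *+ 2
  + a%:P * (a%:P * asin_poly a r) - (r.+1%:R ^+ 2)%:P * asin_poly a r); last by ring.
by rewrite !coefD coefN coefXnM !coefCM coefXM; ring.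
Qed.

(** Real form of the reading of [asin_poly] through [exp (i (X + a) w)]: extracting [X^k] divides by
    [i^k / k!], and the real part of [i^(r-k) exp (i b)] is the cosine. *)
Lemma aderiv_ACosPow_at0 (R : realType) (a b : R) (k r : nat) :
  aeval (iter r (@aderiv R) (AMul (ACosPow a b k) AInvCos)) 0 =
  k`!%:R * (asin_poly a r)`_k * cos ((r%:R - k%:R) * (pi / 2) + b).
Proof.
have o1 : -1 < (0 : R) < 1 by rewrite ltrN10 ltr01.
(* The recurrence has step two, hence two consecutive orders; its source term shifts the phase and
   lowers the exponent, hence all [b] and [k]. *)
suff : forall b k,
  aeval (iter r (@aderiv R) (AMul (ACosPow a b k) AInvCos)) 0 =
  k`!%:R * (asin_poly a r)`_k * cos ((r%:R - k%:R) * (pi / 2) + b) /\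
  aeval (iter r.+1 (@aderiv R) (AMul (ACosPow a b k) AInvCos)) 0 =
  k`!%:R * (asin_poly a r.+1)`_k * cos ((r.+1%:R - k%:R) * (pi / 2) + b).
  by move=> /(_ b k)[].
elim: r {b k} => [|r IH] b k; [|split; first exact: (IH b k).2].
  rewrite /= aderiv_APow !aeval_APow asin0 cos0 coef1 coefD coefX coefC.
  case: k => [|[|k]] /=; rewrite ?exprS ?expr0 ?invr1;
    rewrite ?(mul0r,mulr0,add0r,addr0,mul1r,mulr1,fact0,subr0,subrr,mulNr,oppr0)//.
  by rewrite [b + _]addrC.
have ode := @asin_ode R (ACosPow a b k) (ACosPow1 a b k) (ACosPow2 a b k)
  (fun z _ => aderiv_ACosPow a b k z) (fun z _ => aderiv_ACosPow1 a b k z).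
have {ode} := asin_ode_deriv r ode o1.
rewrite expr0n/= subr0 mul1r mulr0 mul0r add0r => ->.
have -> : aeval (iter r (@aderiv R) (AMul (ACosPow2 a b k) AInvCos)) 0 =
  a ^+ 2 * aeval (iter r (@aderiv R) (AMul (ACosPow a (b + pi / 2 + pi / 2) k) AInvCos)) 0 +
  2 * a * k%:R * aeval (iter r (@aderiv R) (AMul (ACosPow a (b + pi / 2) k.-1) AInvCos)) 0 +
  k%:R * k.-1%:R * aeval (iter r (@aderiv R) (AMul (ACosPow a b k.-2) AInvCos)) 0.
  rewrite -!aderivZ//.
  pose S := AAdd (AAdd (AMul (ACst (a ^+ 2)) (AMul (ACosPow a (b + pi / 2 + pi / 2) k) AInvCos))
    (AMul (ACst (2 * a * k%:R)) (AMul (ACosPow a (b + pi / 2) k.-1) AInvCos)))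
    (AMul (ACst (k%:R * k.-1%:R)) (AMul (ACosPow a b k.-2) AInvCos)).
  transitivity (aeval (iter r (@aderiv R) S) 0); last by rewrite !aderivD.
  have SE z : -1 < z < 1 -> aeval S z = aeval (AMul (ACosPow2 a b k) AInvCos) z.
    by move=> _ /=; ring.
  by rewrite -(derive1n_aeval r SE o1) (derive1n_aeval r (fun _ _ => erefl) o1).
rewrite !(IH _ _).1 asin_polySS.
(* A phase gain of [pi / 2] and a loss of one power of [w] both add a quarter turn. All three source
   terms therefore carry [- c], like the goal, and match the three terms of [(X + a)^2]. *)
set c := cos ((r%:R - k%:R) * (pi / 2) + b).
have c1 : cos ((r%:R - k%:R) * (pi / 2) + (b + pi / 2 + pi / 2)) = - c.
  by rewrite /c -cosDpi; congr cos; field.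
have c2 : cos ((r.+2%:R - k%:R) * (pi / 2) + b) = - c.
  by rewrite /c -cosDpi -[r.+2]addn2 natrD; congr cos; field.
rewrite c1 c2.
case: k @c c1 c2 => [|[|k]] c c1 c2 /=.
- by rewrite !(mul0r,mulr0,addr0,add0r); ring.
- have -> : cos ((r%:R - 0) * (pi / 2) + (b + pi / 2)) = - c.
    by rewrite /c -cosDpi; congr cos; field.
  by rewrite factS fact0 mul1n !(mul0r,mulr0,addr0,add0r,mulr1,mul1r); ring.
- have -> : cos ((r%:R - k.+1%:R) * (pi / 2) + (b + pi / 2)) = - c.
    by rewrite /c -cosDpi -[k.+2]addn1 natrD; congr cos; field.
  have -> : cos ((r%:R - k%:R) * (pi / 2) + b) = - c.
    by rewrite /c -cosDpi -[k.+2]addn2 natrD; congr cos; field.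
  rewrite subn2 /= [k.+2`!]factS [k.+1`!]factS !natrM; ring.
Qed.

(** * Coefficients of [U_(2n-2)(z) (arcsin z)^k]: closed form, sign and parity *)

(** With [v = pi/2 - arcsin z] one has [cos v = z], and the normalization [sin (N v) / sin v] of
    [U_(N-1)] is rewritten through [sin t = cos (pi/2 - t)]. *)
Lemma chebyshevU_asin (R : realType) (n : nat) (z : R) : (1 <= n)%N -> -1 < z < 1 ->
  (chebyshevU R (2 * n - 2)).[z] =
  cos ((2 * n - 1)%:R * asin z + (1 - (2 * n - 1)%:R) * (pi / 2)) / cos (asin z).
Proof.
move=> n1 z1; have c0 := cos_asin_gt0 z1.
have s0 : sin (pi / 2 - asin z) = cos (asin z).
  by rewrite sinB sin_pihalf cos_pihalf; ring.
have <- : cos (pi / 2 - asin z) = z.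
  by rewrite cosB sin_pihalf cos_pihalf asinK ?in_itv/= ?ltW; case/andP: z1 => *; rewrite ?ltW//; ring.
rewrite chebyshevU_cos s0 ?lt0r_neq0//.
have -> : cos (pi / 2 - asin z) = z.
  by rewrite cosB sin_pihalf cos_pihalf asinK ?in_itv/= ?ltW; case/andP: z1 => *; rewrite ?ltW//; ring.
have -> : (2 * n - 2).+1 = (2 * n - 1)%N by lia.
have cs (x : R) : cos (pi / 2 - x) = sin x by rewrite cosB sin_pihalf cos_pihalf; ring.
by rewrite -cs; congr (cos _ / _); ring.
Qed.

Lemma coefUasinE (R : realType) (n r k : nat) : (1 <= n)%N ->
  coefUasin R n r k = k`!%:R / r`!%:R * (asin_poly (2 * n - 1)%:R r)`_k *
    cos ((r%:R - k%:R + 1 - (2 * n - 1)%:R) * (pi / 2)).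
Proof.
move=> n1; pose N := (2 * n - 1)%:R : R.
have o1 : -1 < (0 : R) < 1 by rewrite ltrN10 ltr01.
rewrite /coefUasin /coef_at0.
rewrite (@derive1n_aeval _ _ (AMul (ACosPow N ((1 - N) * (pi / 2)) k) AInvCos)) //.
  rewrite aderiv_ACosPow_at0 -/N (_ : _ * (pi / 2) + _ = (r%:R - k%:R + 1 - N) * (pi / 2)); last by ring.
  by ring.
by move=> z z1; rewrite /= aeval_APow chebyshevU_asin//; ring.
Qed.

(** Each quadratic factor [X^2 + 2 N X + (N^2 - j^2)] has [j < N], hence only positive
    coefficients. *)
Lemma asin_poly_coef_gt0 (R : realType) (N r : nat) : (r <= N)%N ->
  (forall k, 0 <= (asin_poly (N%:R : R) r)`_k) /\
  (forall k, (k <= r)%N -> 0 < (asin_poly (N%:R : R) r)`_k).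
Proof.
suff H : ((r <= N)%N -> (forall k, 0 <= (asin_poly (N%:R : R) r)`_k) /\
  (forall k, (k <= r)%N -> 0 < (asin_poly (N%:R : R) r)`_k)) /\
  ((r.+1 <= N)%N -> (forall k, 0 <= (asin_poly (N%:R : R) r.+1)`_k) /\
  (forall k, (k <= r.+1)%N -> 0 < (asin_poly (N%:R : R) r.+1)`_k)) by exact: H.1.
elim: r => [|r [IH1 IH2]]; split.
- move=> _; split => k; rewrite /= coef1; first by case: eqP.
  by case: k.
- move=> N1; split => k; rewrite /= coefD coefX coefC.
    by rewrite addr_ge0 ?ler0n//; case: eqP; rewrite ?ler0n.
  by case: k => [|[|//]] _; rewrite /= ?add0r ?addr0 ?ltr01 ?ltr0n.
- exact: IH2.
- move=> rN; have [|ge0 gt0] := IH1; first by lia.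
  have N0 : 0 < N%:R :> R by rewrite ltr0n; lia.
  have a0 : 0 < 2 * N%:R :> R by rewrite mulr_gt0.
  have d0 : 0 < (N%:R : R) ^+ 2 - r.+1%:R ^+ 2.
    by rewrite subr_gt0 ltrXn2r// ?nnegrE// ltr_nat.
  split => k; rewrite asin_polySS.
    apply: addr_ge0; last by rewrite mulr_ge0// ltW.
    by apply: addr_ge0; [case: ifP|apply: mulr_ge0; [exact/ltW|case: ifP]].
  move=> kr; case: k kr => [|[|k]] kr /=.
  + by rewrite mulr0 !add0r mulr_gt0// gt0.
  + by rewrite add0r ltr_pwDl ?mulr_ge0 ?(ltW d0)// mulr_gt0 ?gt0.
  + by rewrite subn2/= -addrA ltr_pwDl ?gt0// addr_ge0// mulr_ge0// ltW.
Qed.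

Lemma cos_natmul_pi (R : realType) (m : nat) : cos (m%:R * pi) = (-1) ^+ m :> R.
Proof.
elim: m => [|m IH]; first by rewrite mul0r cos0 expr0.
by rewrite -natr1 mulrDl mul1r cosDpi IH exprS mulN1r.
Qed.

Lemma sin_natmul_pi (R : realType) (m : nat) : sin (m%:R * pi) = 0 :> R.
Proof.
elim: m => [|m IH]; first by rewrite mul0r sin0.
by rewrite -natr1 mulrDl mul1r sinDpi IH oppr0.
Qed.

Lemma coefUasin_even_gt0 (R : realType) (n p : nat) : (1 <= p <= n)%N ->
  0 < (-1) ^+ (p - 1) * coefUasin R n (2 * n) (2 * p).
Proof.
move=> /andP[p1 pn]; have n1 : (1 <= n)%N by lia.
rewrite coefUasinE// (_ : cos _ = (-1) ^+ (p - 1)); last first.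
  rewrite -cos_natmul_pi -cosN; congr cos.
  by rewrite !natrB ?natrM; [field|lia..].
rewrite mulrCA -expr2 sqrr_sign mulr1 mulr_gt0 ?divr_gt0 ?ltr0n ?fact_gt0//.
set N : R := (2 * n - 1)%:R.
(* The order [2n = N + 1] is just beyond [asin_poly_coef_gt0]: the last factor is
   [(X + N)^2 - N^2 = X^2 + 2 N X]. Only its constant term vanishes, and the term [X^2] already
   gives positivity since [2p >= 2]. *)
have -> : (2 * n = (2 * n - 2).+2)%N by lia.
rewrite asin_polySS -/N.
have -> : N ^+ 2 - (2 * n - 2).+1%:R ^+ 2 = 0.
  by rewrite /N (_ : (2 * n - 2).+1 = 2 * n - 1)%N ?subrr//; lia.
have [|ge0 gt0] := @asin_poly_coef_gt0 R (2 * n - 1) (2 * n - 2); first by lia.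
rewrite mul0r addr0 (_ : (2 * p < 2)%N = false); last by lia.
rewrite (_ : (2 * p == 0)%N = false); last by lia.
by rewrite ltr_pwDl ?gt0 ?mulr_ge0//; lia.
Qed.

Lemma coefUasin_odd_gt0 (R : realType) (n p : nat) : (1 <= p <= n)%N ->
  0 < (-1) ^+ (p - 1) * coefUasin R n (2 * n - 1) (2 * p - 1).
Proof.
move=> /andP[p1 pn]; have n1 : (1 <= n)%N by lia.
rewrite coefUasinE// (_ : cos _ = (-1) ^+ (p - 1)); last first.
  rewrite -cos_natmul_pi -cosN; congr cos.
  by rewrite !natrB ?natrM; [field|lia..].
rewrite mulrCA -expr2 sqrr_sign mulr1 mulr_gt0 ?divr_gt0 ?ltr0n ?fact_gt0//.
by have [|ge0 gt0] := @asin_poly_coef_gt0 R (2 * n - 1) (2 * n - 1); [lia|rewrite gt0//; lia].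
Qed.

(** The cosine in [coefUasinE] is then taken at an odd multiple of [pi / 2]; the two cases are the
    signs of that multiple. *)
Lemma coefUasin_parity (R : realType) (n r k : nat) : (1 <= n)%N -> odd (r + k) ->
  coefUasin R n r k = 0.
Proof.
move=> n1 rk; rewrite coefUasinE//; apply/eqP; rewrite mulf_eq0; apply/orP; right.
have [m [m1 | m1]] : exists m : nat, (r + 2 = k + 2 * n + (2 * m + 1) \/ r + 2 + (2 * m + 1) = k + 2 * n)%N.
  case: (leqP (r + 2) (k + 2 * n)) => h.
    by exists ((k + 2 * n - (r + 2)).-1./2); right; lia.
  by exists ((r + 2 - (k + 2 * n)).-1./2); left; lia.
- rewrite (_ : _ * (pi / 2) = m%:R * pi + pi / 2); last first.
    have : (r + 2)%:R = (k + 2 * n + (2 * m + 1))%:R :> R by rewrite m1.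
    rewrite natrB ?natrM ?natrD ?natrM; last by lia.
    by move=> h; have -> : r%:R = k%:R + 2 * n%:R + 2 * m%:R - 1 :> R; [lra|field].
  by rewrite cosD cos_pihalf sin_pihalf mulr0 mulr1 sub0r oppr_eq0 sin_natmul_pi.
- rewrite (_ : _ * (pi / 2) = - (m%:R * pi + pi / 2)); last first.
    have : (r + 2 + (2 * m + 1))%:R = (k + 2 * n)%:R :> R by rewrite m1.
    rewrite natrB ?natrM ?natrD ?natrM; last by lia.
    by move=> h; have -> : r%:R = k%:R + 2 * n%:R - 2 * m%:R - 3 :> R; [lra|field].
  by rewrite cosN cosD cos_pihalf sin_pihalf mulr0 mulr1 sub0r oppr_eq0 sin_natmul_pi.
Qed.

(** * Taylor polynomials with a uniform remainder *)

Definition ataylor (R : realType) (e : asin_expr R) (M : nat) : {poly R} :=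
  \poly_(i < M) (aeval (iter i (@aderiv R) e) 0 / i`!%:R).

Lemma deriv_ataylor (R : realType) (e : asin_expr R) (M : nat) :
  (ataylor e M.+1)^`() = ataylor (aderiv e) M.
Proof.
apply/polyP => i; rewrite coef_deriv !coef_poly ltnS.
case: ltnP => // _; last by rewrite mul0rn.
rewrite iterSr factS natrM invfM -mulr_natr.
by field; rewrite pnatr_eq0 -lt0n fact_gt0 nat1r pnatr_eq0.
Qed.

(** Stopping at [1 / 2] keeps [1 / cos (arcsin z)] away from its singularity at 1. *)
Lemma aeval_bounded (R : realType) (e : asin_expr R) :
  exists2 C : R, 0 <= C & forall z : R, 0 <= z <= 1 / 2 -> `|aeval e z| <= C.
Proof.
elim: e => [||||a b|e1 [C1 C10 H1] e2 [C2 C20 H2]|e1 [C1 C10 H1] e2 [C2 C20 H2]] /=.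
- by exists 1 => // z /andP[z0 z1]; rewrite ger0_norm//; lra.
- exists 2 => // z z1; have z1' : -1 < z < 1 by case/andP: z1 => *; apply/andP; split; lra.
  have c0 := cos_asin_gt0 z1'; have := invcos_asin_sqr z1'.
  rewrite ger0_norm ?invr_ge0 ?(ltW c0)//; set h := _^-1 => h1.
  rewrite leNgt; apply/negP => h2.
  have a : 3 / 4 <= 1 - z ^+ 2 by case/andP: z1 => *; nra.
  have b : 4 < h ^+ 2 by nra.
  by nra.
- exists (pi / 2); first by rewrite divr_ge0 ?pi_ge0.
  move=> z /andP[z0 z1]; rewrite ler_norml asin_geNpi2 ?asin_lepi2//; apply/andP; split; lra.
- by move=> c; exists `|c|.
- by exists 1 => // z _; rewrite cos_max.
- exists (C1 + C2); first exact: addr_ge0.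
  by move=> z z1; rewrite (le_trans (ler_normD _ _))// lerD ?H1 ?H2.
- exists (C1 * C2); first exact: mulr_ge0.
  by move=> z z1; rewrite normrM ler_pM ?H1 ?H2.
Qed.

(** The derivative of the remainder of [e] is the remainder, one order lower, of [aderiv e]; the
    mean value theorem returns the missing power of [z]. *)
Lemma aeval_ataylor (R : realType) (e : asin_expr R) (M : nat) :
  exists2 C : R, 0 <= C & forall z : R, 0 <= z <= 1 / 2 ->
    `|aeval e z - (ataylor e M).[z]| <= C * z ^+ M.
Proof.
elim: M e => [|M IH] e.
  have [C C0 HC] := aeval_bounded e; exists C => // z z1.
  rewrite (_ : ataylor e 0 = 0); first by rewrite hornerC subr0 expr0 mulr1 HC.
  by apply/polyP => i; rewrite coef_poly coef0.
have [C C0 HC] := IH (aderiv e); exists C => // z /andP[z0 z1].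
pose g : R -> R := aeval e - horner (ataylor e M.+1).
have dg (x : R) : -1 < x < 1 ->
    is_derive x 1 g (aeval (aderiv e) x - (ataylor (aderiv e) M).[x]).
  move=> x1; rewrite -deriv_ataylor.
  exact: (is_deriveB (is_derive_aeval e x1) (is_derive_poly _ _)).
have g0 : g 0 = 0.
  by rewrite /g !fctE horner_coef0 coef_poly/= fact0 divr1 subrr.
have I (x : R) : x \in `[0, z] -> -1 < x < 1.
  by rewrite in_itv/= => /andP[? ?]; apply/andP; split; lra.
have [||c c0z] := @MVT_segment R g
    (fun x => aeval (aderiv e) x - (ataylor (aderiv e) M).[x]) 0 z z0.
- by move=> x x0; apply/dg/I; exact: subset_itv_oo_cc.
- apply: derivable_within_continuous => x /I x1.
  by case: (dg x x1).
rewrite g0 !subr0 -[aeval e z - _]/(g z) => ->.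
move: c0z; rewrite in_itv/= => /andP[c0 cz].
rewrite normrM (ger0_norm z0) exprSr mulrA ler_wpM2r//.
rewrite (le_trans (HC c _))//; first by apply/andP; split; lra.
by rewrite ler_wpM2l// lerXn2r// nnegrE.
Qed.

(** * Taylor bounds for trigonometric and hyperbolic functions *)

(** Engine of the section: most bounds below integrate an earlier one from 0. *)
Lemma le_of_deriv (R : realType) (f g df dg : R -> R) (a : R) :
  (forall x : R, is_derive x 1 f (df x)) -> (forall x : R, is_derive x 1 g (dg x)) ->
  f 0 <= g 0 -> (forall x : R, 0 <= x <= a -> df x <= dg x) ->
  forall x : R, 0 <= x <= a -> f x <= g x.
Proof.
move=> dfE dgE fg0 dfg x /andP[x0 xa].
have dh (y : R) : is_derive y 1 (g - f) (dg y - df y) by exact: is_deriveB.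
have ch : {within `[0, x], continuous (g - f)}.
  by apply: derivable_within_continuous => y _; case: (dh y).
have [c] := MVT_segment x0 (fun y _ => dh y) ch.
rewrite in_itv/= subr0 => /andP[c0 cx] E.
have d : 0 <= (dg c - df c) * x.
  by rewrite mulr_ge0// subr_ge0 dfg// c0 (le_trans cx).
by move: E; rewrite !fctE; lra.
Qed.

Definition monom (R : realType) (c : R) (m : nat) (x : R) : R := c * x ^+ m.

Lemma is_derive_monom (R : realType) (c : R) (m : nat) (x : R) :
  is_derive x 1 (monom c m.+1) (m.+1%:R * c * x ^+ m).
Proof.
have -> : monom c m.+1 = horner (c%:P * 'X^(m.+1))%R.
  by apply/funext => y; rewrite /monom !hornerE ?hornerXn.
apply: (is_derive_eq (is_derive_poly _ _)).
by rewrite derivM derivC derivXn -scaler_nat !hornerE/=; ring.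
Qed.

Lemma is_derive_sinh (R : realType) (x : R) : is_derive x 1 (@sinh R) (cosh x).
Proof.
have dN : is_derive x 1 (expR \o -%R) (expR (- x) * - 1).
  exact: (@is_derive1_comp R expR (-%R) x).
have d2 := is_deriveM (is_deriveB (is_derive_expR x) dN) (is_derive_cst (2^-1 : R) x 1).
apply: (is_derive_eq d2).
by rewrite scaler0 add0r /GRing.scale/= /cosh; field.
Qed.

Lemma is_derive_cosh (R : realType) (x : R) : is_derive x 1 (@cosh R) (sinh x).
Proof.
have dN : is_derive x 1 (expR \o -%R) (expR (- x) * - 1).
  exact: (@is_derive1_comp R expR (-%R) x).
have d2 := is_deriveM (is_deriveD (is_derive_expR x) dN) (is_derive_cst (2^-1 : R) x 1).
apply: (is_derive_eq d2).
by rewrite scaler0 add0r /GRing.scale/= /sinh; field.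
Qed.

Lemma cosh0 (R : realType) : cosh (0 : R) = 1.
Proof. by rewrite /cosh oppr0 expR0; field. Qed.

Lemma sinh0 (R : realType) : sinh (0 : R) = 0.
Proof. by rewrite /sinh oppr0 subrr mul0r. Qed.

Lemma cosh_ge1 (R : realType) (x : R) : 1 <= cosh x.
Proof.
have e0 := expR_ge0 (- x); have ee := expRxMexpNx_1 x.
rewrite /cosh; move: (expR x) (expR (- x)) e0 ee => a b b0 ab.
have : 0 <= b * (a - 1) ^+ 2 by rewrite mulr_ge0 ?sqr_ge0.
rewrite (_ : _ * _ = (a * b) * a - 2 * (a * b) + b); last by ring.
by rewrite ab; lra.
Qed.

Lemma sin_le_id (R : realType) (y : R) : 0 <= y -> sin y <= y.
Proof.
move=> y0; have {2}-> : y = monom 1 1 y by rewrite /monom mul1r.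
apply: (@le_of_deriv R sin (monom 1 1) _ _ y (@is_derive_sin R) (is_derive_monom 1 0)); last by rewrite y0 lexx.
  by rewrite sin0 /monom mulr0.
by move=> x _; rewrite expr0 !mulr1 cos_le1.
Qed.

Lemma cos_ge_taylor (R : realType) (y : R) : 0 <= y -> 1 - y ^+ 2 / 2 <= cos y.
Proof.
move=> y0; have -> : 1 - y ^+ 2 / 2 = (cst 1 + monom (- 2^-1) 2) y :> R by rewrite fctE /monom/=; ring.
apply: (@le_of_deriv R _ cos _ _ y (fun x : R => is_deriveD (is_derive_cst (1 : R) x 1) (is_derive_monom (- 2^-1) 1 x))
  (@is_derive_cos R)); last by rewrite y0 lexx.
  by rewrite fctE cos0 /monom expr2 !mulr0 addr0.
by move=> x /andP[/sin_le_id x0 _]; rewrite expr1; lra.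
Qed.

Lemma sin_ge_taylor (R : realType) (y : R) : 0 <= y -> y - y ^+ 3 / 6 <= sin y.
Proof.
move=> y0; have -> : y - y ^+ 3 / 6 = (monom 1 1 + monom (- 6^-1) 3) y by rewrite fctE /monom/=; ring.
apply: (@le_of_deriv R _ sin _ _ y (fun x : R => is_deriveD (is_derive_monom 1 0 x) (is_derive_monom (- 6^-1) 2 x))
  (@is_derive_sin R)); last by rewrite y0 lexx.
  by rewrite fctE sin0 /monom !exprS !(mulr0, mul0r) addr0.
by move=> x /andP[/cos_ge_taylor x0 _]; rewrite expr0; lra.
Qed.

Lemma cos_le_taylor (R : realType) (y : R) : 0 <= y ->
  cos y <= 1 - y ^+ 2 / 2 + y ^+ 4 / 24.
Proof.
move=> y0; have -> : 1 - y ^+ 2 / 2 + y ^+ 4 / 24 = (cst 1 + (monom (- 2^-1) 2 + monom 24^-1 4)) y :> R.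
  by rewrite !fctE /monom/=; ring.
apply: (@le_of_deriv R cos _ _ _ y (@is_derive_cos R) (fun x : R => is_deriveD (is_derive_cst (1 : R) x 1)
  (is_deriveD (is_derive_monom (- 2^-1) 1 x) (is_derive_monom 24^-1 3 x)))); last by rewrite y0 lexx.
  by rewrite !fctE cos0 /monom !exprS !(mulr0, mul0r) !addr0.
by move=> x /andP[/sin_ge_taylor x0 _]; rewrite expr1; lra.
Qed.

Lemma sinh_ge_id (R : realType) (y : R) : 0 <= y -> y <= sinh y.
Proof.
move=> y0; have {1}-> : y = monom 1 1 y by rewrite /monom mul1r.
apply: (@le_of_deriv R _ (@sinh R) _ _ y (is_derive_monom 1 0) (@is_derive_sinh R)); last by rewrite y0 lexx.
  by rewrite sinh0 /monom mulr0.
by move=> x _; rewrite expr0 !mulr1 cosh_ge1.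
Qed.

Lemma cosh_ge_taylor (R : realType) (y : R) : 0 <= y -> 1 + y ^+ 2 / 2 <= cosh y.
Proof.
move=> y0; have -> : 1 + y ^+ 2 / 2 = (cst 1 + monom 2^-1 2) y :> R by rewrite fctE /monom/=; ring.
apply: (@le_of_deriv R _ (@cosh R) _ _ y (fun x : R => is_deriveD (is_derive_cst (1 : R) x 1) (is_derive_monom 2^-1 1 x))
  (@is_derive_cosh R)); last by rewrite y0 lexx.
  by rewrite fctE cosh0 /monom expr2 !mulr0 addr0.
by move=> x /andP[/sinh_ge_id x0 _]; rewrite expr1; lra.
Qed.

(** Seed of the upper bounds on [[0, 1]]: four integrations carry the constant [expR 1] into the
    last Taylor term. *)
Lemma cosh_le_expR1 (R : realType) (y : R) : 0 <= y <= 1 -> cosh y <= expR 1.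
Proof.
move=> /andP[y0 y1]; rewrite /cosh.
have a : expR y <= expR 1 by rewrite ler_expR.
have b : expR (- y) <= expR 1 by rewrite ler_expR; lra.
lra.
Qed.

Lemma sinh_le_linear (R : realType) (y : R) : 0 <= y <= 1 -> sinh y <= expR 1 * y.
Proof.
move=> y01; have -> : expR 1 * y = monom (expR 1) 1 y by [].
apply: (@le_of_deriv R (@sinh R) _ _ _ 1 (@is_derive_sinh R) (is_derive_monom (expR 1) 0)) => //.
  by rewrite sinh0 /monom mulr0.
by move=> x /cosh_le_expR1; rewrite expr0; lra.
Qed.

Lemma cosh_le_quadratic (R : realType) (y : R) : 0 <= y <= 1 ->
  cosh y <= 1 + expR 1 * y ^+ 2 / 2.
Proof.
move=> y01; have -> : 1 + expR 1 * y ^+ 2 / 2 = (cst 1 + monom (expR 1 / 2) 2) y :> R.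
  by rewrite fctE /monom/=; ring.
apply: (@le_of_deriv R (@cosh R) _ _ _ 1 (@is_derive_cosh R)
  (fun x : R => is_deriveD (is_derive_cst (1 : R) x 1) (is_derive_monom (expR 1 / 2) 1 x))) => //.
  by rewrite !fctE cosh0 /monom !exprS !(mulr0, mul0r) !addr0.
by move=> x /sinh_le_linear; rewrite expr1; lra.
Qed.

Lemma sinh_le_cubic (R : realType) (y : R) : 0 <= y <= 1 ->
  sinh y <= y + expR 1 * y ^+ 3 / 6.
Proof.
move=> y01; have -> : y + expR 1 * y ^+ 3 / 6 = (monom 1 1 + monom (expR 1 / 6) 3) y :> R.
  by rewrite fctE /monom/=; ring.
apply: (@le_of_deriv R (@sinh R) _ _ _ 1 (@is_derive_sinh R)
  (fun x : R => is_deriveD (is_derive_monom 1 0 x) (is_derive_monom (expR 1 / 6) 2 x))) => //.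
  by rewrite !fctE sinh0 /monom !exprS !(mulr0, mul0r) !addr0.
by move=> x /cosh_le_quadratic; rewrite expr0; lra.
Qed.

Lemma cosh_le_quartic (R : realType) (y : R) : 0 <= y <= 1 ->
  cosh y <= 1 + y ^+ 2 / 2 + expR 1 * y ^+ 4 / 24.
Proof.
move=> y01; have -> : 1 + y ^+ 2 / 2 + expR 1 * y ^+ 4 / 24 =
    (cst 1 + (monom 2^-1 2 + monom (expR 1 / 24) 4)) y :> R.
  by rewrite !fctE /monom/=; ring.
apply: (@le_of_deriv R (@cosh R) _ _ _ 1 (@is_derive_cosh R)
  (fun x : R => is_deriveD (is_derive_cst (1 : R) x 1) (is_deriveD (is_derive_monom 2^-1 1 x)
    (is_derive_monom (expR 1 / 24) 3 x)))) => //.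
  by rewrite !fctE cosh0 /monom !exprS !(mulr0, mul0r) !addr0.
by move=> x /sinh_le_cubic; rewrite expr1; lra.
Qed.

(** * Partial fractions of sinh x / (cosh x - cos v) *)

(** With [t = y / 2], [1 - cos y = 2 (sin t)^2], and [sin t >= t - t^3 / 6 >= t / 3] as long as
    [t <= 2]. *)
Lemma one_sub_cos_ge (R : realType) (y : R) : 0 <= y <= pi -> y ^+ 2 / 18 <= 1 - cos y.
Proof.
move=> /andP[y0 y1]; have p2 := pihalf_lt2 R.
pose t := y / 2.
have t0 : 0 <= t by rewrite /t; lra.
have t2 : t <= 2 by rewrite /t; lra.
have -> : cos y = 1 - 2 * sin t ^+ 2.
  rewrite (_ : y = t + t); last by rewrite /t; field.
  by rewrite cosD -!expr2 cos2sin2; ring.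
have s : t / 3 <= sin t.
  apply: le_trans (sin_ge_taylor t0).
  have : 0 <= t * (4 - t ^+ 2) by rewrite mulr_ge0//; nra.
  by rewrite mulrBr -exprS; lra.
have : (t / 3) ^+ 2 <= sin t ^+ 2.
  by rewrite lerXn2r// nnegrE ?(le_trans _ s)//; lra.
have -> : y = 2 * t by rewrite /t; field.
by rewrite !exprMn; lra.
Qed.

Definition kern (R : realType) (x v : R) : R := sinh x / (cosh x - cos v).

(** Joint contribution [1 / (x - i y) + 1 / (x + i y)] of a pair of conjugate poles. *)
Definition cauchy_kern (R : realType) (x y : R) : R := 2 * x / (x ^+ 2 + y ^+ 2).

Lemma cosh_gt1 (R : realType) (x : R) : 0 < x -> 1 < cosh x.
Proof.
move=> x0; apply: lt_le_trans (cosh_ge_taylor (ltW x0)).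
by rewrite ltrDl divr_gt0// exprn_gt0.
Qed.

(** Over a common denominator the leading terms cancel: the numerator is at most
    [e u (u^2 + y^2)^2], the denominator at least [(u^2 + y^2)^2 / 18]. The bound is uniform in [y],
    so it survives averaging over many angles. *)
Lemma kern_sub_cauchy (R : realType) (u y : R) : 0 < u <= 1 -> 0 <= y <= pi ->
  `|kern u y - cauchy_kern u y| <= 18 * expR 1 * u.
Proof.
move=> /andP[u0 u1] ypi; have /andP[y0 y1] := ypi.
have u01 : 0 <= u <= 1 by rewrite (ltW u0).
have K1 : 1 <= expR 1 :> R by rewrite -expR0 ler_expR.
have A0 := sinh_ge_id (ltW u0); have A1 := sinh_le_cubic u01.
have B0 := cosh_ge_taylor (ltW u0); have B1 := cosh_le_quartic u01.
have E0 := cos_ge_taylor y0; have E1 := cos_le_taylor y0.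
have D := one_sub_cos_ge ypi.
set K := expR 1 in K1 A1 B1 *.
have r0 : 0 < u ^+ 2 + y ^+ 2 by rewrite ltr_pwDl ?sqr_ge0// exprn_gt0.
have d0 : (u ^+ 2 + y ^+ 2) / 18 <= cosh u - cos y.
  have := sqr_ge0 u; lra.
have d1 : 0 < cosh u - cos y by apply: lt_le_trans d0; rewrite divr_gt0.
pose N := sinh u * (u ^+ 2 + y ^+ 2) - 2 * u * (cosh u - cos y).
have -> : kern u y - cauchy_kern u y = N / ((cosh u - cos y) * (u ^+ 2 + y ^+ 2)).
  by rewrite /kern /cauchy_kern /N; field; rewrite !lt0r_neq0.
have NK : `|N| <= K * u * (u ^+ 2 + y ^+ 2) ^+ 2.
  pose A := sinh u - u; pose B := cosh u - 1 - u ^+ 2 / 2; pose E := cos y - 1 + y ^+ 2 / 2.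
  have -> : N = A * (u ^+ 2 + y ^+ 2) - 2 * u * B + 2 * u * E by rewrite /N /A /B /E; field.
  have {A0 A1} [A0 A1] : 0 <= A /\ A <= K * u ^+ 3 / 6 by rewrite /A; split; lra.
  have {B0 B1} [B0 B1] : 0 <= B /\ B <= K * u ^+ 4 / 24 by rewrite /B; split; lra.
  have {E0 E1} [E0 E1] : 0 <= E /\ E <= y ^+ 4 / 24 by rewrite /E; split; lra.
  clear D d0 d1.
  have [U Y] : 0 <= u ^+ 2 /\ 0 <= y ^+ 2 by rewrite !sqr_ge0.
  have uB : 0 <= u * B by rewrite mulr_ge0// ltW.
  have uE : 0 <= u * E by rewrite mulr_ge0// ltW.
  have Ar : 0 <= A * (u ^+ 2 + y ^+ 2) by rewrite mulr_ge0// ltW.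
  have uB' : u * B <= K * u * (u ^+ 2 * u ^+ 2) / 24.
    rewrite (le_trans (ler_wpM2l (ltW u0) B1))// le_eqVlt; apply/orP; left; apply/eqP; ring.
  have uE' : u * E <= K * u * (y ^+ 2 * y ^+ 2) / 24.
    rewrite (le_trans (ler_wpM2l (ltW u0) E1))//.
    have : 0 <= (K - 1) * (u * (y ^+ 2 * y ^+ 2)).
      by rewrite mulr_ge0 ?subr_ge0// mulr_ge0 ?(ltW u0)// mulr_ge0.
    rewrite (_ : y ^+ 4 = y ^+ 2 * y ^+ 2); last by ring.
    by lra.
  have Ar' : A * (u ^+ 2 + y ^+ 2) <= K * u * (u ^+ 2 * (u ^+ 2 + y ^+ 2)) / 6.
    rewrite (le_trans (ler_wpM2r (ltW r0) A1))// le_eqVlt; apply/orP; left; apply/eqP; ring.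
  have -> : (u ^+ 2 + y ^+ 2) ^+ 2 = u ^+ 2 * u ^+ 2 + 2 * (u ^+ 2 * y ^+ 2) + y ^+ 2 * y ^+ 2 by ring.
  have Ku : 0 <= K * u by rewrite mulr_ge0 ?(ltW u0)//; lra.
  move: (mulr_ge0 Ku (mulr_ge0 U U)) (mulr_ge0 Ku (mulr_ge0 U Y)) (mulr_ge0 Ku (mulr_ge0 Y Y)).
  by clearbody A B E => *; rewrite ler_norml; apply/andP; split; lra.
rewrite normrM normfV (gtr0_norm (mulr_gt0 d1 r0)) ler_pdivrMr ?mulr_gt0//.
rewrite (le_trans NK)//.
have -> : K * u * (u ^+ 2 + y ^+ 2) ^+ 2 =
  18 * K * u * ((u ^+ 2 + y ^+ 2) / 18 * (u ^+ 2 + y ^+ 2)) by field.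
by rewrite ler_wpM2l ?ler_wpM2r ?(ltW r0)// !mulr_ge0 ?(ltW u0)//; lra.
Qed.

(** On a full period both [0] and [2 pi] may be the nearest pole. The farther one, at distance at
    least [pi], costs at most [u], which is the extra 1 in the constant. *)
Lemma kern_sub_cauchy_sym (R : realType) (u y : R) : 0 < u <= 1 -> 0 < y < 2 * pi ->
  `|kern u y - cauchy_kern u y - cauchy_kern u (2 * pi - y)| <= (18 * expR 1 + 1) * u.
Proof.
move=> u01 /andP[y0 y2]; have p2 := pi_ge2 R; have /andP[u0 u1] := u01.
have small (w : R) : pi <= w -> 0 <= cauchy_kern u w <= u.
  move=> pw; have w2 : 2 <= w ^+ 2 by nra.
  have d0 : 0 < u ^+ 2 + w ^+ 2 by have := sqr_ge0 u; lra.
  rewrite /cauchy_kern divr_ge0 ?(ltW d0) ?mulr_ge0 ?(ltW u0)//= ler_pdivrMr//.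
  by rewrite mulrC ler_wpM2l ?(ltW u0)//; have := sqr_ge0 u; lra.
case: (leP y pi) => yp.
  have ypi : 0 <= y <= pi by rewrite (ltW y0).
  have := kern_sub_cauchy u01 ypi; have /small/andP[] : pi <= 2 * pi - y by lra.
  by move=> a b; rewrite !ler_norml => /andP[c d]; apply/andP; split; lra.
have ypi : 0 <= 2 * pi - y <= pi by apply/andP; split; lra.
have := kern_sub_cauchy u01 ypi; have /andP[] := small _ (ltW yp).
have -> : kern u (2 * pi - y) = kern u y.
  by rewrite /kern -[in LHS]cosN opprB mulr_natl -(cosD2pi (y - _)) subrK.
by move=> a b; rewrite !ler_norml => /andP[c d]; apply/andP; split; lra.
Qed.

Lemma kern_duplication (R : realType) (u v : R) : 0 < u ->
  kern u v = (kern (u / 2) (v / 2) + kern (u / 2) (v / 2 + pi)) / 2.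
Proof.
move=> u0; have c1 : 1 < cosh (u / 2) by rewrite cosh_gt1 ?divr_gt0.
rewrite /kern cosDpi.
have ch t : cosh (t + t) = 2 * cosh t ^+ 2 - 1 :> R.
  have ee := expRxMexpNx_1 t.
  rewrite /cosh opprD !expRD; move: (expR t) (expR (- t)) ee => a b ab.
  have -> : (a * a + b * b) / 2 = 2 * ((a + b) / 2) ^+ 2 - a * b by field.
  by rewrite ab.
have sh t : sinh (t + t) = 2 * sinh t * cosh t :> R.
  by rewrite /cosh /sinh opprD !expRD; field.
have uu : u = u / 2 + u / 2 by field.
have cv : cos v = 2 * cos (v / 2) ^+ 2 - 1.
  rewrite {1}(_ : v = v / 2 + v / 2); last by field.
  by rewrite cosD -!expr2 sin2cos2; ring.
rewrite [in LHS]uu ch sh cv; have := cos_le1 (v / 2); have := cos_geN1 (v / 2).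
move: (cosh _) (sinh _) (cos _) c1 => C S c C1 c2 c3.
field; apply/and3P; split=> //; try (apply: lt0r_neq0; nra).
Qed.

Lemma kern_duplication_iter (R : realType) (x v : R) (N : nat) : 0 < x ->
  kern x v = (\sum_(j < 2 ^ N) kern (x / 2 ^+ N) ((v + 2 * pi * j%:R) / 2 ^+ N)) / 2 ^+ N.
Proof.
move=> x0; elim: N => [|N IH].
  by rewrite big_ord1 expr0 !divr1 mulr0 addr0.
have p0 k : 0 < 2 ^+ k :> R by rewrite exprn_gt0.
(* Shifting a halved angle by [pi] amounts to shifting its index by [2 ^ N], so the two halves of
   the new index range come from the two terms of the duplication. *)
rewrite IH expnS mul2n -addnn big_split_ord/= -big_split/= !mulr_suml.
apply: eq_bigr => j _.
rewrite kern_duplication ?divr_gt0// exprS natrD natrX.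
have -> : x / 2 ^+ N / 2 = x / (2 * 2 ^+ N) by field; rewrite lt0r_neq0.
have -> : (v + 2 * pi * j%:R) / 2 ^+ N / 2 = (v + 2 * pi * j%:R) / (2 * 2 ^+ N).
  by field; rewrite lt0r_neq0.
have -> : (v + 2 * pi * j%:R) / (2 * 2 ^+ N) + pi =
  (v + 2 * pi * (2 ^+ N + j%:R)) / (2 * 2 ^+ N) by field; rewrite lt0r_neq0.
by rewrite invfM; ring.
Qed.

Lemma cauchy_kern_scale (R : realType) (x y c : R) : c != 0 ->
  cauchy_kern (x / c) (y / c) / c = cauchy_kern x y.
Proof.
move=> c0; rewrite /cauchy_kern.
have -> : (x / c) ^+ 2 + (y / c) ^+ 2 = (x ^+ 2 + y ^+ 2) / c ^+ 2 by field.
have [->|r0] := eqVneq (x ^+ 2 + y ^+ 2) 0; first by rewrite mul0r !invr0 !mulr0 mul0r.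
by field; rewrite c0 r0.
Qed.

Definition kern_sum (R : realType) (x v : R) (N : nat) : R :=
  \sum_(j < 2 ^ N) (cauchy_kern x (v + 2 * pi * j%:R) +
                    cauchy_kern x (2 * pi - v + 2 * pi * j%:R)).

(** [x <= 2 ^ N] puts the scaled variable in [(0, 1]]. An average of [2 ^ N] errors, each at most
    [C x / 2 ^ N], obeys the same bound. *)
Lemma kern_sum_dist (R : realType) (x v : R) (N : nat) :
  0 < x <= 2 ^+ N -> 0 < v < 2 * pi ->
  `|kern x v - kern_sum x v N| <= (18 * expR 1 + 1) * x / 2 ^+ N.
Proof.
move=> /andP[x0 x1] /andP[v0 v1].
have p0 : 0 < 2 ^+ N :> R by rewrite exprn_gt0.
have pi0 := pi_gt0 R.
have -> : kern_sum x v N = \sum_(j < 2 ^ N) (cauchy_kern x (v + 2 * pi * j%:R) +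
    cauchy_kern x (2 * pi * 2 ^+ N - (v + 2 * pi * j%:R))).
  rewrite /kern_sum !big_split/=; congr (_ + _).
  (* The second poles, measured from [2 pi 2 ^ N], come in reverse order. *)
  rewrite (reindex_inj rev_ord_inj); apply: eq_bigr => j _; congr cauchy_kern.
  by rewrite /= natrB// natrX -natr1; ring.
rewrite (kern_duplication_iter v N x0) mulr_suml -sumrB.
apply: le_trans (ler_norm_sum _ _ _) _.
have -> : (18 * expR 1 + 1) * x / 2 ^+ N =
    \sum_(j < 2 ^ N) ((18 * expR 1 + 1) * (x / 2 ^+ N) / 2 ^+ N).
  rewrite sumr_const card_ord -[RHS]mulr_natr natrX.
  by field; rewrite lt0r_neq0.
apply: ler_sum => j _.
rewrite -(cauchy_kern_scale x (v + _) (lt0r_neq0 p0)).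
rewrite -(cauchy_kern_scale x (_ - _) (lt0r_neq0 p0)) -mulrDl -mulrBl.
rewrite normrM (gtr0_norm (_ : 0 < (2 ^+ N)^-1)) ?invr_gt0//.
rewrite ler_wpM2r ?invr_ge0 ?(ltW p0)//.
have -> : (2 * pi * 2 ^+ N - (v + 2 * pi * j%:R)) / 2 ^+ N =
  2 * pi - (v + 2 * pi * j%:R) / 2 ^+ N by field; rewrite lt0r_neq0.
rewrite opprD addrA kern_sub_cauchy_sym//.
  by rewrite divr_gt0//= ler_pdivrMr// mul1r.
have jN : j%:R + 1 <= 2 ^+ N :> R by rewrite natr1 -natrX ler_nat.
rewrite divr_gt0 ?ltr_pwDl ?mulr_ge0 ?(ltW pi0)//= ltr_pdivrMr//.
have : 2 * pi * (j%:R + 1) <= 2 * pi * 2 ^+ N :> R by rewrite ler_wpM2l ?mulr_ge0 ?(ltW pi0).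
lra.
Qed.

Lemma kern_sum_cvg (R : realType) (x v : R) : 0 < x -> 0 < v < 2 * pi ->
  kern_sum x v N @[N --> \oo] --> kern x v.
Proof.
move=> x0 v02; apply/cvgrPdist_le => e e0.
pose C := (18 * expR 1 + 1) * x.
have /cvgrPdist_le H : C * (2^-1 ^+ N) @[N --> \oo] --> C * (0 : R).
  by apply: cvgMr; apply: cvg_expr; rewrite ger0_norm; lra.
have /cvgrPdist_le H2 : x * (2^-1 ^+ N) @[N --> \oo] --> x * (0 : R).
  by apply: cvgMr; apply: cvg_expr; rewrite ger0_norm; lra.
near=> N.
have p0 : 0 < 2 ^+ N :> R by rewrite exprn_gt0.
apply: le_trans (kern_sum_dist _ v02) _.
  rewrite x0/=; have : `|x * 0 - x * 2^-1 ^+ N| <= 1 by near: N; exact: H2.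
  rewrite mulr0 sub0r normrN exprVn ger0_norm ?mulr_ge0 ?(ltW x0) ?invr_ge0 ?(ltW p0)//.
  by rewrite ler_pdivrMr// mul1r.
have : `|C * 0 - C * 2^-1 ^+ N| <= e by near: N; exact: H.
rewrite mulr0 sub0r normrN exprVn; apply: le_trans.
exact: ler_norm.
Unshelve. all: by end_near. Qed.

(** * Integrals over the half-line *)

(** Integrability is bundled with the value, so that linear combinations and comparisons carry both
    at once. *)
Definition has_int (R : realType) (f : R -> R) (v : R) : Prop :=
  (@lebesgue_measure R).-integrable `]0, +oo[%classic (EFin \o f) /\
  (\int[lebesgue_measure]_(x in `]0%R, +oo[%classic) (f x)%:E = v%:E)%E.

Lemma has_intD (R : realType) (f g : R -> R) (v w : R) :
  has_int f v -> has_int g w -> has_int (fun x => f x + g x) (v + w).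
Proof.
move=> [if1 fv] [ig1 gw]; split.
  exact: (integrableD _ if1 ig1).
rewrite -[LHS]/(\int[lebesgue_measure]_(x in `]0%R, +oo[%classic) ((EFin \o f) \+ (EFin \o g)) x)%E.
by rewrite integralD_EFin// /= fv gw.
Qed.

Lemma has_intZ (R : realType) (f : R -> R) (v c : R) :
  has_int f v -> has_int (fun x => c * f x) (c * v).
Proof.
move=> [if1 fv]; split.
  exact: (integrableZl _ c if1).
rewrite -[LHS]/(\int[lebesgue_measure]_(x in `]0%R, +oo[%classic) (c%:E * (EFin \o f) x))%E.
by rewrite integralZl// /= fv.
Qed.

Lemma has_int_ext (R : realType) (f g : R -> R) (v : R) :
  (forall x, 0 < x -> f x = g x) -> has_int f v -> has_int g v.
Proof.
move=> fg [if1 fv].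
have fgD : {in (`]0, +oo[%classic : set R), EFin \o f =1 EFin \o g}.
  by move=> x; rewrite inE/= in_itv/= andbT => x0; rewrite /= fg.
split; first by move: if1; apply: eq_integrable => // x xD; exact: fgD.
by rewrite -fv; apply: eq_integral => x xD; have /= := fgD x xD.
Qed.

Lemma has_int0 (R : realType) : has_int (cst (0 : R)) 0.
Proof.
by split; [exact: integrable0|rewrite integral0].
Qed.

Lemma has_int_sum (R : realType) (I : Type) (r : seq I) (P : pred I) (f : I -> R -> R) (v : I -> R) :
  (forall i, P i -> has_int (f i) (v i)) ->
  has_int (fun x => \sum_(i <- r | P i) f i x) (\sum_(i <- r | P i) v i).
Proof.
move=> fv; elim: r => [|i r IH].
  rewrite big_nil; apply: has_int_ext (has_int0 R) => x _; by rewrite big_nil.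
rewrite big_cons; case: ifPn => Pi.
  by apply: has_int_ext (has_intD (fv i Pi) IH) => x _; rewrite big_cons Pi.
by apply: has_int_ext IH => x _; rewrite big_cons (negbTE Pi).
Qed.

Lemma has_int_le (R : realType) (f g : R -> R) (v w : R) :
  (forall x, 0 < x -> f x <= g x) -> has_int f v -> has_int g w -> v <= w.
Proof.
move=> fg [if1 fv] [ig1 gw]; rewrite -lee_fin -fv -gw.
apply: le_integral => // x; rewrite inE/= in_itv/= andbT => x0.
by rewrite lee_fin fg.
Qed.

Lemma integrable_has_int (R : realType) (f : R -> R) :
  (@lebesgue_measure R).-integrable `]0, +oo[%classic (EFin \o f) ->
  exists v, has_int f v.
Proof.
move=> if1; exists (fine (\int[lebesgue_measure]_(x in `]0%R, +oo[%classic) (f x)%:E)%E).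
by split => //; rewrite fineK//; exact: integrable_fin_num if1.
Qed.

Lemma measurable_halfline (R : realType) (f : R -> R) :
  (forall x : R, 0 < x -> {for x, continuous f}) -> measurable_fun (`]0, +oo[%classic : set R) f.
Proof.
move=> cf; apply: measurable_realfun.open_continuous_measurable_fun; first exact: interval_open.
by move=> x; rewrite inE/= in_itv/= andbT; exact: cf.
Qed.

Lemma has_int_dominated (R : realType) (f g : R -> R) (w : R) :
  (forall x : R, 0 < x -> {for x, continuous f}) ->
  (forall x, 0 < x -> `|f x| <= g x) -> has_int g w -> exists v, has_int f v.
Proof.
move=> cf fg [ig1 _]; apply: integrable_has_int.
apply: le_integrable ig1 => //.
  by apply/measurable_realfun.measurable_EFinP; exact: measurable_halfline.
move=> x; rewrite /= in_itv/= andbT => x0; rewrite lee_fin.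
by rewrite (le_trans (fg x x0))// ler_norm.
Qed.

Lemma has_int_limit (R : realType) (f_ : nat -> R -> R) (f g : R -> R) (a_ : nat -> R) (w : R) :
  (forall x : R, 0 < x -> {for x, continuous f}) ->
  (forall x, 0 < x -> f_ N x @[N --> \oo] --> f x) ->
  (forall N x, 0 < x -> `|f_ N x| <= g x) -> has_int g w ->
  (forall N, has_int (f_ N) (a_ N)) ->
  exists2 A : R, has_int f A & a_ N @[N --> \oo] --> A.
Proof.
move=> cf fl fg [ig1 _] fa.
have [|||||| if1 _ lim] := @dominated_convergence _ _ R (@lebesgue_measure R) `]0%R, +oo[%classic
  _ (fun N => EFin \o f_ N) (EFin \o f) (EFin \o g).
- by [].
- by move=> N; have [/integrableP[]] := fa N.
- by apply/measurable_realfun.measurable_EFinP; exact: measurable_halfline.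
- apply: aeW => x; rewrite /= in_itv/= andbT => x0.
  by apply: cvg_EFin; [near=> N|exact: fl].
- by [].
- apply: aeW => x N; rewrite /= in_itv/= andbT => x0.
  by rewrite lee_fin fg.
have [A fA] := integrable_has_int if1.
exists A => //; move: lim; rewrite fA.2.
rewrite (_ : [sequence _]_n = fun N => (a_ N)%:E); last first.
  by apply/funext => N; rewrite /= (fa N).2.
by move/fine_cvgP => [_].
Unshelve. all: by end_near. Qed.

Lemma has_int_cauchy (R : realType) (b : R) : 0 < b ->
  has_int (fun x => 2 / (x ^+ 2 + b ^+ 2)) (pi / b).
Proof.
move=> b0.
have d0 x : 0 < x ^+ 2 + b ^+ 2 by rewrite ltr_wpDl ?sqr_ge0// exprn_gt0.
pose f x := 2 / (x ^+ 2 + b ^+ 2).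
have cf (x : R) : {for x, continuous f}.
  rewrite /f; apply: cvgM; first exact: cvg_cst.
  apply: cvgV; first by rewrite lt0r_neq0.
  by apply: cvgD; [apply: exprn_continuous|exact: cvg_cst].
pose F x := 2 / b * atan (b^-1 * x).
have dF (x : R) : is_derive x 1 F (f x).
  have dl := is_deriveZ (b^-1 : R) (is_derive_id x 1).
  have da := @is_derive1_comp R (@atan R) (fun x => b^-1 *: x) x _ _ (is_derive1_atan _) dl.
  have dm := is_deriveZ (2 / b : R) da.
  apply: (is_derive_eq dm).
  rewrite /GRing.scale/= /f; field.
  by rewrite !lt0r_neq0// addrC.
have I : (\int[lebesgue_measure]_(x in `[0%R, +oo[%classic) (f x)%:E = (pi / b)%:E)%E.
  rewrite (@ge0_continuous_FTC2y R f F 0 (2 / b * (pi / 2))).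
  - by rewrite /F mulr0 atan0 mulr0 -EFinB subr0; congr EFin; field; rewrite lt0r_neq0.
  - by move=> x _; rewrite /f divr_ge0// ltW.
  - by apply: continuous_subspaceT => x; exact: cf.
  - apply: cvgMr.
    have h : b^-1 * x @[x --> +oo] --> +oo by apply: gt0_cvgMry; rewrite ?invr_gt0//; exact: cvg_id.
    exact: (cvg_comp _ _ h (@cvgy_atan R)).
  - by move=> x _; case: (dF x).
  - apply: cvg_at_right_filter; apply: differentiable_continuous.
    by apply/derivable1_diffP; case: (dF 0).
  - by move=> x _; rewrite derive1E; have ? := dF x; rewrite derive_val.
have mf : measurable_fun (`]0%R, +oo[%classic : set R) f.
  by apply: measurable_halfline => x _; exact: cf.
have I2 : (\int[lebesgue_measure]_(x in `]0%R, +oo[%classic) (f x)%:E = (pi / b)%:E)%E.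
  (* The fundamental theorem was applied on the closed half-line; its endpoint has measure zero. *)
  by rewrite -I integral_itv_obnd_cbnd//; exact/measurable_realfun.measurable_EFinP.
split=> //; apply/integrableP; split; first exact/measurable_realfun.measurable_EFinP.
rewrite (_ : integral _ _ _ = (pi / b)%:E) ?ltry// -I2.
by apply: eq_integral => x _; rewrite /= ger0_norm// /f divr_ge0// ltW.
Qed.

(** * The integrals of [sinh x / (x cosh^(m+1) x)] *)

Lemma continuous_sinh (R : realType) (x : R) : {for x, continuous (@sinh R)}.
Proof.
apply: differentiable_continuous; apply/derivable1_diffP.
by case: (is_derive_sinh x).
Qed.

Lemma continuous_cosh (R : realType) (x : R) : {for x, continuous (@cosh R)}.
Proof.
apply: differentiable_continuous; apply/derivable1_diffP.
by case: (is_derive_cosh x).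
Qed.

Lemma cosh_gt0 (R : realType) (x : R) : 0 < cosh x.
Proof. by apply: lt_le_trans (cosh_ge1 x). Qed.

Lemma sinh_ge0 (R : realType) (x : R) : 0 <= x -> 0 <= sinh x.
Proof. by move=> x0; apply: le_trans (sinh_ge_id x0). Qed.

Lemma sinh_le_mul_cosh (R : realType) (x : R) : 0 <= x -> sinh x <= x * cosh x.
Proof.
move=> x0; have d (y : R) := is_deriveM (is_derive_id y 1) (is_derive_cosh y).
apply: (le_of_deriv (@is_derive_sinh R) d (a := x)); last by rewrite x0 lexx.
  by rewrite sinh0 fctE /= mul0r.
move=> y /andP[y0 _]; rewrite /GRing.scale/= mulr1 lerDr.
by rewrite mulr_ge0 ?sinh_ge0.
Qed.

Definition tau_fun (R : realType) (m : nat) (x : R) : R := sinh x / (x * cosh x ^+ m.+1).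

Lemma tau_fun_ge0 (R : realType) (m : nat) (x : R) : 0 < x -> 0 <= tau_fun m x.
Proof.
move=> x0; rewrite /tau_fun divr_ge0 ?sinh_ge0 ?ltW//.
by rewrite mulr_gt0// exprn_gt0// cosh_gt0.
Qed.

(** From [sinh x <= x cosh x] the function is at most [1 / cosh x], hence at most [2 / (x^2 + 1)].
    At [m = 0] it would be [tanh x / x], which is not integrable. *)
Lemma has_int_tau_fun (R : realType) (m : nat) : (0 < m)%N ->
  exists v : R, has_int (tau_fun m) v.
Proof.
move=> m0; apply: has_int_dominated (has_int_cauchy (@ltr01 R)).
  move=> x x0; apply: cvgM; first exact: continuous_sinh.
  apply: cvgV; first by rewrite mulf_neq0 ?lt0r_neq0// exprn_gt0// cosh_gt0.
  apply: cvgM; first exact: cvg_id.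
  apply: (@continuous_comp R R R (@cosh R) (fun y => y ^+ m.+1)); first exact: continuous_cosh.
  exact: exprn_continuous.
move=> x x0; rewrite ger0_norm ?tau_fun_ge0//.
have c1 := cosh_ge1 x; have c0 := cosh_gt0 x.
have cm : cosh x <= cosh x ^+ m by rewrite ler_eXnr.
have ct := cosh_ge_taylor (ltW x0).
rewrite /tau_fun ler_pdivrMr ?mulr_gt0 ?exprn_gt0//.
apply: le_trans (sinh_le_mul_cosh (ltW x0)) _.
have d0 : 0 < x ^+ 2 + 1 ^+ 2 :> R by rewrite expr1n; have := sqr_ge0 x; lra.
have h (r : R) : 2 / r * (x * cosh x ^+ m.+1) = x * cosh x * (2 * cosh x ^+ m / r).
  by rewrite exprS; ring.
rewrite h.
rewrite ler_peMr ?mulr_ge0 ?(ltW x0) ?(ltW c0)// ler_pdivlMr// mul1r expr1n.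
lra.
Qed.

(** * The integrated partial fractions *)

Lemma telescope_bound (R : realType) (u w : nat -> R) (n : nat) :
  (forall j, 0 <= u j) -> (forall j, w j <= u j) -> (forall j, u j.+1 <= w j) ->
  0 <= \sum_(j < n) (u j - w j) <= u 0%N.
Proof.
move=> u0 wu uw; rewrite sumr_ge0/= => [|j _]; last by rewrite subr_ge0.
suff : \sum_(j < n) (u j - w j) <= u 0%N - u n.
  by move=> h; apply: le_trans h _; rewrite gerBl.
elim: n => [|n IH]; first by rewrite big_ord0 subrr.
by rewrite big_ord_recr/=; have := uw n; lra.
Qed.

Definition pole1 (R : realType) (j : nat) : R := pi / 2 + 2 * pi * j%:R.
Definition pole3 (R : realType) (j : nat) : R := 2 * pi - pi / 2 + 2 * pi * j%:R.

Definition int_sum (R : realType) (s : R) (N : nat) : R :=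
  \sum_(j < 2 ^ N) (pi / (pole1 R j - s) - pi / pole1 R j +
                    (pi / (pole3 R j + s) - pi / pole3 R j)).

(** Subtracting the value at [s = 0] cancels the [1/x] tail, so that the quotient becomes
    integrable. *)
Definition kern_diff (R : realType) (s x : R) : R :=
  (kern x (pi / 2 - s) - kern x (pi / 2)) / x.

Lemma pole1_ge (R : realType) (j : nat) : pi / 2 <= pole1 R j.
Proof. by rewrite /pole1 lerDl !mulr_ge0 ?pi_ge0. Qed.

Lemma pole3_ge (R : realType) (j : nat) : pi / 2 <= pole3 R j.
Proof.
rewrite /pole3; have : 0 <= 2 * pi * j%:R :> R by rewrite !mulr_ge0 ?pi_ge0.
by have := pi_ge0 R; lra.
Qed.

(** Dominated convergence on the truncated partial fractions, whose integrals are [int_sum s N]. The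
    value [A] stays anonymous: it only links the two expansions. *)
Lemma kern_diff_int (R : realType) (s : R) : 0 < s <= pi / 6 ->
  exists2 A : R, has_int (kern_diff s) A & int_sum s N @[N --> \oo] --> A.
Proof.
move=> /andP[s0 s1]; have pi0 := pi_gt0 R.
pose L (x y : R) : R := 2 / (x ^+ 2 + y ^+ 2).
have Lint y : 0 < y -> has_int (L^~ y) (pi / y) by exact: has_int_cauchy.
have Lle (x y y' : R) : 0 < y -> y <= y' -> L x y' <= L x y.
  move=> y0 yy; have d0 : 0 < x ^+ 2 + y ^+ 2 by rewrite ltr_wpDl ?sqr_ge0// exprn_gt0.
  have yy2 : y ^+ 2 <= y' ^+ 2 by rewrite lerXn2r// nnegrE; lra.
  by rewrite /L ler_pM2l// lef_pV2 ?posrE//; lra.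
have L0 (x y : R) : 0 < y -> 0 <= L x y.
  by move=> y0; rewrite /L divr_ge0// addr_ge0 ?sqr_ge0.
pose f_ N (x : R) := \sum_(j < 2 ^ N) (L x (pole1 R j - s) - L x (pole1 R j) +
  (L x (pole3 R j + s) - L x (pole3 R j))).
have p1 j := pole1_ge R j; have p3 j := pole3_ge R j.
have p1S j : pole1 R j.+1 = pole1 R j + 2 * pi by rewrite /pole1 -natr1; ring.
have p3S j : pole3 R j.+1 = pole3 R j + 2 * pi by rewrite /pole3 -natr1; ring.
apply: (@has_int_limit R f_ (kern_diff s) (fun x => L x (pole1 R 0 - s) + L x (pole3 R 0))
   (int_sum s) (pi / (pole1 R 0 - s) + pi / pole3 R 0)).
- move=> x x0; have c1 := cosh_gt1 x0.
  have ck (v : R) : kern y v @[y --> x] --> kern x v.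
    apply: cvgM; first exact: continuous_sinh.
    apply: cvgV; first by apply: lt0r_neq0; have := cos_le1 v; lra.
    by apply: cvgB; [exact: continuous_cosh|exact: cvg_cst].
  apply: cvgM; first by apply: cvgB; exact: ck.
  by apply: cvgV; [rewrite lt0r_neq0|exact: cvg_id].
- move=> x x0.
  rewrite (_ : (fun N => f_ N x) = fun N => (kern_sum x (pi / 2 - s) N - kern_sum x (pi / 2) N) / x).
    apply: cvgMl; apply: cvgB; apply: kern_sum_cvg => //; apply/andP; split; lra.
  apply/funext => N; rewrite /kern_sum -sumrB mulr_suml; apply: eq_bigr => j _.
  have cL y : cauchy_kern x y = x * L x y by rewrite /cauchy_kern /L; ring.
  have -> : pi / 2 - s + 2 * pi * j%:R = pole1 R j - s by rewrite /pole1; ring.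
  have -> : 2 * pi - (pi / 2 - s) + 2 * pi * j%:R = pole3 R j + s by rewrite /pole3; ring.
  rewrite -/(pole1 R j) -/(pole3 R j) !cL.
  move: (L _ _) (L _ _) (L _ _) (L _ _) => a b c d.
  by field; rewrite lt0r_neq0.
- (* Each difference of consecutive terms telescopes, because the poles are
     2 pi apart while s < 2 pi; this gives a dominating function uniform in N. *)
  move=> N x x0.
  have /andP[a0 a1] : 0 <= \sum_(j < 2 ^ N) (L x (pole1 R j - s) - L x (pole1 R j)) <= L x (pole1 R 0 - s).
    apply: (@telescope_bound R (fun j => L x (pole1 R j - s)) (fun j => L x (pole1 R j))) => j;
      have p1j := p1 j.
    - apply: L0; lra.
    - apply: Lle; lra.
    - apply: Lle; rewrite ?p1S; lra.
  have /andP[b0 b1] : 0 <= \sum_(j < 2 ^ N) (L x (pole3 R j) - L x (pole3 R j + s)) <= L x (pole3 R 0).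
    apply: (@telescope_bound R (fun j => L x (pole3 R j)) (fun j => L x (pole3 R j + s))) => j;
      have p3j := p3 j.
    - apply: L0; lra.
    - apply: Lle; lra.
    - apply: Lle; rewrite ?p3S; lra.
  rewrite /f_ big_split/=.
  have -> : \sum_(j < 2 ^ N) (L x (pole3 R j + s) - L x (pole3 R j)) =
      - \sum_(j < 2 ^ N) (L x (pole3 R j) - L x (pole3 R j + s)).
    by rewrite -sumrN; apply: eq_bigr => j _; rewrite opprB.
  rewrite ler_norml; apply/andP; split; lra.
- apply: has_intD; apply: Lint; have := p1 0%N; have := p3 0%N; lra.
- move=> N; apply: has_int_sum => j _.
  have hB f g v w : has_int f v -> has_int g w -> has_int (fun x => f x - g x) (v - w) :> Prop.
    move=> hf hg; have := has_intD hf (has_intZ (-1) hg); rewrite mulN1r.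
    by apply: has_int_ext => x _; rewrite mulN1r.
  apply: has_intD; apply: hB; apply: Lint; have := p1 j; have := p3 j; lra.
Qed.

(** Since [cos (pi/2 - s) = sin s = z], this integrates the finite geometric expansion of
    [1 / (cosh x - z) - 1 / cosh x]. The factor 2 comes from [cosh x - z >= cosh x / 2]. *)
Lemma kern_diff_tau (R : realType) (tau : nat -> R) (s A : R) (M : nat) :
  (forall m, (0 < m)%N -> has_int (tau_fun m) (tau m)) ->
  0 < s <= 1 / 3 -> has_int (kern_diff s) A ->
  `|A - \sum_(1 <= m < M.+1) tau m * sin s ^+ m| <= 2 * tau M.+1 * sin s ^+ M.+1.
Proof.
move=> htau /andP[s0 s1] hA.
have sS := sin_le_id (ltW s0).
have z0 : 0 < sin s by apply: sin_gt0_pi; have := pi_ge2 R; rewrite s0/=; lra.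
set z := sin s in z0 sS *.
pose rem (x : R) := sinh x / (x * cosh x ^+ M.+1 * (cosh x - z)).
have remE (x : R) : 0 < x ->
    kern_diff s x + (- 1) * (\sum_(1 <= m < M.+1) z ^+ m * tau_fun m x) = z ^+ M.+1 * rem x.
  move=> x0; have c1 := cosh_gt1 x0; have c0 : 0 < cosh x by lra.
  have d0 : 0 < cosh x - z by lra.
  rewrite /kern_diff /kern /rem cos_pihalf subr0 cosB cos_pihalf sin_pihalf mul0r add0r mul1r -/z.
  elim: M {rem} => [|M IH].
    by rewrite big_geq// expr1 mulr0 addr0; field; rewrite !lt0r_neq0.
  rewrite big_nat_recr//= mulrDr addrA IH /tau_fun.
  rewrite [cosh x ^+ M.+2]exprS [z ^+ M.+2]exprS.
  have cM : cosh x ^+ M.+1 != 0 by rewrite lt0r_neq0// exprn_gt0.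
  by field; rewrite cM !lt0r_neq0.
have : has_int (fun x => z ^+ M.+1 * rem x)
    (A - \sum_(1 <= m < M.+1) tau m * z ^+ m).
  have -> : A - \sum_(1 <= m < M.+1) tau m * z ^+ m =
      A + (-1) * \sum_(1 <= m < M.+1) z ^+ m * tau m.
    by rewrite mulN1r; congr (_ - _); apply: eq_bigr => m _; rewrite mulrC.
  apply: (has_int_ext remE).
  have hS : has_int (fun x => \sum_(1 <= m < M.+1) z ^+ m * tau_fun m x) (\sum_(1 <= m < M.+1) z ^+ m * tau m).
    rewrite big_nat_cond; under eq_fun do rewrite big_nat_cond.
    by apply: has_int_sum => m /andP[/andP[m1 _] _]; apply/has_intZ/htau.
  exact: has_intD hA (has_intZ (-1) hS).
move=> hR.
have r0 (x : R) : 0 < x -> 0 <= rem x /\ rem x <= 2 * tau_fun M.+1 x.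
  move=> x0; have c1 := cosh_gt1 x0; have c0 : 0 < cosh x by lra.
  have d0 : 0 < cosh x - z by lra.
  have p0 : 0 < x * cosh x ^+ M.+1 by rewrite mulr_gt0// exprn_gt0.
  have sh := sinh_ge0 (ltW x0).
  split; first by rewrite /rem divr_ge0// ltW// mulr_gt0.
  have -> : 2 * tau_fun M.+1 x = sinh x / (x * cosh x ^+ M.+1 * (cosh x / 2)).
    rewrite /tau_fun [cosh x ^+ M.+2]exprS.
    by field; rewrite !lt0r_neq0// exprn_gt0.
  have q1 : 0 < x * cosh x ^+ M.+1 * (cosh x / 2) by rewrite mulr_gt0// divr_gt0.
  have q2 : 0 < x * cosh x ^+ M.+1 * (cosh x - z) by rewrite mulr_gt0.
  rewrite /rem ler_wpM2l// lef_pV2 ?posrE// ler_wpM2l ?(ltW p0)//; lra.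
have hT := has_intZ (z ^+ M.+1) (has_intZ 2 (htau M.+1 isT)).
have zM : 0 <= z ^+ M.+1 by rewrite exprn_ge0// ltW.
rewrite ger0_norm.
  rewrite mulrC; apply: has_int_le hR hT => x x0.
  by rewrite ler_wpM2l//; case: (r0 x x0).
apply: has_int_le (has_int0 R) hR => x x0.
by rewrite mulr_ge0//; case: (r0 x x0).
Qed.

(** * Expansion in powers of [s] *)

(** For [l >= 1], the coefficient of [s^l] in [int_sum s N]. *)
Definition omega_sum (R : realType) (l N : nat) : R :=
  pi * \sum_(j < 2 ^ N) ((pole1 R j)^-1 ^+ l.+1 + (- 1) ^+ l * (pole3 R j)^-1 ^+ l.+1).

Lemma inv_sub_geometric (R : realType) (b s : R) (M : nat) : b != 0 -> b - s != 0 ->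
  (b - s)^-1 - b^-1 = \sum_(1 <= l < M.+1) s ^+ l * b^-1 ^+ l.+1
    + s ^+ M.+1 * (b^-1 ^+ M.+1 * (b - s)^-1).
Proof.
move=> b0 bs0; elim: M => [|M IH].
  by rewrite big_geq// add0r !expr1; field; rewrite ?b0 ?bs0.
rewrite IH [in RHS]big_nat_recr//= -!addrA; congr (_ + _).
rewrite [b^-1 ^+ M.+2]exprS [s ^+ M.+2]exprS.
by field; rewrite ?b0 ?bs0 ?expf_neq0.
Qed.

(** Telescoping with [1 / (j+1)^2 <= 1 / j - 1 / (j+1)] for [j >= 1]. *)
Lemma sum_inv_sqr_le2 (R : realType) (n : nat) :
  \sum_(j < n) (j.+1%:R^-1 ^+ 2) <= 2 :> R.
Proof.
suff : \sum_(j < n.+1) (j.+1%:R^-1 ^+ 2) <= 2 - n.+1%:R^-1 :> R.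
  rewrite big_ord_recr/= => h.
  have h1 : 0 <= n.+1%:R^-1 :> R by [].
  apply: le_trans (_ : 2 - n.+1%:R^-1 <= _); last by rewrite gerBl.
  by apply: le_trans h; rewrite lerDl sqr_ge0.
elim: n => [|n IH]; first by rewrite big_ord1 invr1 expr1n; lra.
rewrite big_ord_recr/=.
suff h : (n.+2%:R^-1 ^+ 2) <= n.+1%:R^-1 - n.+2%:R^-1 :> R.
  apply: le_trans (lerD IH h) _; rewrite le_eqVlt; apply/orP; left; apply/eqP; ring.
have a0 : 0 < n.+1%:R :> R by [].
have -> : n.+2%:R = n.+1%:R + 1 :> R by rewrite natr1.
move: (n.+1%:R : R) a0 => a a0.
have -> : a^-1 - (a + 1)^-1 = a^-1 * (a + 1)^-1 by field; rewrite !lt0r_neq0//; lra.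
have a1 : 0 < a + 1 by lra.
by rewrite expr2 ler_wpM2r ?invr_ge0 ?(ltW a1)// lef_pV2 ?posrE//; lra.
Qed.

(** The geometric remainder at index [j] is at most [(2 + 1) / (j+1)^2], one share for each pole,
    and the inverse squares sum to at most 2; hence 6. Being uniform in [N], the bound passes to the
    limit. *)
Lemma int_sum_omega (R : realType) (omega : nat -> R) (s A : R) (M : nat) :
  (forall l, (0 < l)%N -> omega_sum R l N @[N --> \oo] --> omega l) ->
  0 < s <= 1 / 3 -> int_sum s N @[N --> \oo] --> A ->
  `|A - \sum_(1 <= l < M.+1) omega l * s ^+ l| <= 6 * pi * s ^+ M.+1.
Proof.
move=> hom /andP[s0 s1] hA; have pi2 := pi_ge2 R.
have lim : (int_sum s N - \sum_(1 <= l < M.+1) omega_sum R l N * s ^+ l) @[N --> \oo] -->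
    A - \sum_(1 <= l < M.+1) omega l * s ^+ l.
  apply: cvgB => //; rewrite big_nat_cond.
  under eq_fun do rewrite big_nat_cond.
  apply: cvg_big => [|l]; first exact: add_continuous.
  move=> /andP[/andP[l0 _] _].
  by apply: cvgMl; exact: hom.
have {}lim := cvg_norm (FF := eventually_filter) lim.
rewrite -(cvg_lim (@Rhausdorff R) lim); apply: limr_le; first exact: cvgP lim.
apply: nearW => N.
have p1 j : j.+1%:R <= pole1 R j.
  rewrite /pole1 -natr1; have : 0 <= (pi - 2) * j%:R :> R by rewrite mulr_ge0 ?subr_ge0.
  by have : 0 <= j%:R :> R by []; lra.
have p3 j : j.+1%:R <= pole3 R j.
  by apply: le_trans (p1 j) _; rewrite /pole1 /pole3; lra.
have -> : int_sum s N - \sum_(1 <= l < M.+1) omega_sum R l N * s ^+ l =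
  pi * s ^+ M.+1 * \sum_(j < 2 ^ N) ((pole1 R j)^-1 ^+ M.+1 * (pole1 R j - s)^-1 +
     (-1) ^+ M.+1 * ((pole3 R j)^-1 ^+ M.+1 * (pole3 R j + s)^-1)).
  rewrite /int_sum /omega_sum.
  under [X in _ - X]eq_bigr do rewrite mulrAC mulr_sumr.
  rewrite exchange_big/= -sumrB mulr_sumr; apply: eq_bigr => j _.
  have j0 : 1 <= j.+1%:R :> R by rewrite ler1n.
  have := p1 j; have := p3 j.
  move: (pole1 R j) (pole3 R j) => b c hc hb.
  have b0 : b != 0 by rewrite lt0r_neq0//; lra.
  have c0 : c != 0 by rewrite lt0r_neq0//; lra.
  have bs0 : b - s != 0 by rewrite lt0r_neq0//; lra.
  have cs0 : c - - s != 0 by rewrite lt0r_neq0//; lra.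
  have e1 := inv_sub_geometric M b0 bs0; have e3 := inv_sub_geometric M c0 cs0.
  rewrite opprK in e3.
  have -> : pi / (b - s) - pi / b + (pi / (c + s) - pi / c) =
    pi * ((b - s)^-1 - b^-1) + pi * ((c + s)^-1 - c^-1) by ring.
  rewrite e1 e3.
  have -> : \sum_(1 <= l < M.+1) pi * s ^+ l * (b^-1 ^+ l.+1 + (-1) ^+ l * c^-1 ^+ l.+1) =
    pi * \sum_(1 <= l < M.+1) s ^+ l * b^-1 ^+ l.+1 +
    pi * \sum_(1 <= l < M.+1) (- s) ^+ l * c^-1 ^+ l.+1.
    rewrite -mulrDr -big_split/= mulr_sumr; apply: eq_bigr => l _.
    by rewrite [(- s) ^+ l]exprNn; ring.
  by rewrite [(- s) ^+ M.+1]exprNn; ring.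
have sM : 0 <= pi * s ^+ M.+1 by rewrite mulr_ge0 ?exprn_ge0 ?pi_ge0// ltW.
rewrite normrM ger0_norm//.
have -> : 6 * pi * s ^+ M.+1 = pi * s ^+ M.+1 * 6 by ring.
rewrite ler_wpM2l//.
apply: le_trans (ler_norm_sum _ _ _) _.
have h2 := sum_inv_sqr_le2 R (2 ^ N).
apply: (@le_trans _ _ (3 * \sum_(j < 2 ^ N) (j.+1%:R^-1 ^+ 2))); last by lra.
rewrite mulr_sumr; apply: ler_sum => j _.
have j0 : 1 <= j.+1%:R :> R by rewrite ler1n.
have := p1 j; have := p3 j.
move: (pole1 R j) (pole3 R j) (j.+1%:R : R) j0 => b c a a1 hc hb.
have a0 : 0 < a by lra.
have ib (y : R) : a <= y -> 0 <= y^-1 ^+ M.+1 <= a^-1.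
  move=> ay; have y0 : 0 < y by lra.
  rewrite exprn_ge0 ?invr_ge0 ?(ltW y0)//=.
  apply: (@le_trans _ _ y^-1); last by rewrite lef_pV2.
  rewrite exprS ler_piMr ?invr_ge0 ?(ltW y0)// exprn_ile1 ?invr_ge0 ?(ltW y0)//.
  by rewrite invf_le1//; lra.
have /andP[b0 b1] := ib b hb; have /andP[c0 c1] := ib c hc.
have bs : (b - s)^-1 <= 2 * a^-1.
  have -> : 2 * a^-1 = (a / 2)^-1 by field; rewrite lt0r_neq0.
  by rewrite lef_pV2 ?posrE//; lra.
have cs : (c + s)^-1 <= a^-1 by rewrite lef_pV2 ?posrE//; lra.
have bs0 : 0 <= (b - s)^-1 by rewrite invr_ge0; lra.
have cs0 : 0 <= (c + s)^-1 by rewrite invr_ge0; lra.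
apply: le_trans (ler_normD _ _) _.
rewrite [`|_ ^+ _ * (_ * _)|]normrM normrX normrN1 expr1n mul1r.
rewrite !ger0_norm ?mulr_ge0//.
have i0 : 0 <= a^-1 by rewrite invr_ge0 ltW.
have e1 : b^-1 ^+ M.+1 * (b - s)^-1 <= a^-1 * (2 * a^-1) by exact: ler_pM.
have e2 : c^-1 ^+ M.+1 * (c + s)^-1 <= a^-1 * a^-1 by exact: ler_pM.
by rewrite expr2; lra.
Qed.

(** * Comparison of the two expansions *)

(** Arbitrarily small points suffice: continuity kills the constant coefficient, and dividing by
    ['X] lowers the order by one. *)
Lemma coef_eq0_of_small (R : realType) (M : nat) (C : R) (p : {poly R}) :
  (forall e : R, 0 < e -> exists z : R, [/\ 0 < z, z < e & `|p.[z]| <= C * z ^+ M]) ->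
  forall i, (i < M)%N -> p`_i = 0.
Proof.
elim: M p => [//|M IH] p H.
have p0 : p`_0 = 0.
  apply/eqP/negP => /negP c0.
  pose e := `|p`_0| / 2; have e0 : 0 < e by rewrite divr_gt0// normr_gt0.
  have /cvgrPdist_lt/(_ e e0) := @continuous_horner R p 0.
  rewrite horner_coef0 => /nbhs_ballP[d /= d0 hd].
  pose K := `|C| + 1; have K0 : 0 < K by rewrite /K; have := normr_ge0 C; lra.
  have [|z [z0 zm hz]] := H (Num.min d (Num.min 1 (e / K))).
    by rewrite !lt_min d0 ltr01 divr_gt0.
  move: zm; rewrite !lt_min => /and3P[zd z1 ze].
  have h1 : `|p`_0 - p.[z]| < e.
    by apply: hd; rewrite -ball_normE /= sub0r normrN gtr0_norm.
  have h2 : C * z ^+ M.+1 <= e.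
    apply: (@le_trans _ _ (K * z)); last by rewrite mulrC -ler_pdivlMr// ltW.
    apply: (@le_trans _ _ (K * z ^+ M.+1)).
      by rewrite ler_wpM2r ?exprn_ge0 ?(ltW z0)// /K; have := ler_norm C; lra.
    by rewrite ler_wpM2l ?(ltW K0)// exprS ler_piMr ?(ltW z0)// exprn_ile1 ?ltW.
  have : `|p`_0| <= `|p`_0 - p.[z]| + `|p.[z]|.
    by have := ler_normD (p`_0 - p.[z]) p.[z]; rewrite subrK.
  by rewrite /e in h1 h2 *; lra.
have pX : p = (p %/ 'X) * 'X.
  by rewrite divpK// -['X]subr0 -(polyC0 R) dvdp_XsubCl /root horner_coef0 p0.
have HQ : forall i, (i < M)%N -> (p %/ 'X)`_i = 0.
  apply: IH => e e0; have [z [z0 ze hz]] := H e e0; exists z; split=> //.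
  move: hz; rewrite {1}pX hornerM hornerX normrM (gtr0_norm z0) exprSr mulrA.
  by rewrite ler_pM2r.
by case=> [//|i] iM; rewrite pX coefMX/= HQ.
Qed.

(** * Zeta and beta values *)

Lemma cvgn_subseq (R : realType) (u : nat -> R) (l : R) (f : nat -> nat) :
  (forall n, (n <= f n)%N) -> u n @[n --> \oo] --> l -> u (f n) @[n --> \oo] --> l.
Proof.
move=> nf /cvgrPdist_le H; apply/cvgrPdist_le => e e0.
have [N _ hN] := H e e0; exists N => // n Nn.
by apply: hN => /=; exact: leq_trans Nn (nf n).
Qed.

Lemma sum_even_odd (V : zmodType) (F : nat -> V) (n : nat) :
  \sum_(j < n) (F (2 * j)%N + F (2 * j + 1)%N) = \sum_(i < 2 * n) F i.
Proof.
elim: n => [|n IH]; first by rewrite !big_ord0.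
by rewrite mulnS addnC addn2 !big_ord_recr/= -IH addn1 -addrA.
Qed.

Lemma inv_pow_ge0 (R : realType) (q j : nat) : 0 <= (j%:R : R)^-1 ^+ q.
Proof. by rewrite exprn_ge0. Qed.

Lemma inv_pow_le_sqr (R : realType) (q j : nat) : (2 <= q)%N ->
  (j.+1%:R : R)^-1 ^+ q <= j.+1%:R^-1 ^+ 2.
Proof.
by move=> q2; rewrite ler_wiXn2l// invf_le1// ler1n.
Qed.

Lemma cvg_inv_pow (R : realType) (q : nat) : (2 <= q)%N ->
  cvgn (series (fun j => (j.+1%:R : R)^-1 ^+ q)).
Proof.
move=> q2; apply: nondecreasing_is_cvgn.
  apply/nondecreasing_seqP => n; rewrite /series/= big_nat_recr//= lerDl.
  exact: inv_pow_ge0.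
exists 2 => _ [n _ <-]; rewrite /series/= big_mkord.
apply: le_trans (sum_inv_sqr_le2 R n); apply: ler_sum => j _.
exact: inv_pow_le_sqr.
Qed.

Lemma zetaE (R : realType) (q : nat) :
  zeta (q%:R : R) = limn (series (fun j => (j.+1%:R : R)^-1 ^+ q)).
Proof.
rewrite /zeta; congr (limn (series _)); apply/funext => j.
by rewrite powR_mulrn// exprVn.
Qed.

Lemma zeta_cvg (R : realType) (q : nat) : (2 <= q)%N ->
  \sum_(j < n) ((j.+1%:R : R)^-1 ^+ q) @[n --> \oo] --> zeta (q%:R : R).
Proof.
move=> q2; rewrite zetaE.
rewrite (_ : (fun n => \sum_(j < n) _) = series (fun j => (j.+1%:R : R)^-1 ^+ q)).
  exact: cvg_inv_pow.
by apply/funext => n; rewrite /series/= big_mkord.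
Qed.

Lemma zeta_gt0 (R : realType) (q : nat) : (2 <= q)%N -> 0 < zeta (q%:R : R).
Proof.
move=> q2; apply: (@lt_le_trans _ _ 1) => //.
have h := @zeta_cvg R q q2; rewrite -(cvg_lim (@Rhausdorff R) h).
apply: limr_ge; first exact: cvgP h.
exists 1%N => // n /= n1; case: n n1 => // n _.
by rewrite big_ord_recl/= invr1 expr1n lerDl sumr_ge0// => j _; exact: inv_pow_ge0.
Qed.

Lemma odd_zeta_cvg (R : realType) (q : nat) : (2 <= q)%N ->
  \sum_(j < n) (((2 * j + 1)%:R : R)^-1 ^+ q) @[n --> \oo] -->
  (1 - 2^-1 ^+ q) * zeta (q%:R : R).
Proof.
move=> q2; have h := @zeta_cvg R q q2.
have h2 : \sum_(j < 2 * n) ((j.+1%:R : R)^-1 ^+ q) @[n --> \oo] --> zeta (q%:R : R).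
  by apply: (@cvgn_subseq R _ _ (fun n => (2 * n)%N)) h => n; lia.
rewrite mulrBl mul1r.
rewrite (_ : (fun n => \sum_(j < n) _) = fun n => \sum_(j < 2 * n) ((j.+1%:R : R)^-1 ^+ q)
    - 2^-1 ^+ q * \sum_(j < n) ((j.+1%:R : R)^-1 ^+ q)).
  by apply: cvgB => //; apply: cvgMr.
apply/funext => n.
rewrite -(sum_even_odd (fun j => (j.+1%:R : R)^-1 ^+ q)) big_split/= mulr_sumr.
rewrite [X in _ + X - _](_ : _ = \sum_(j < n) (2^-1 ^+ q * (j.+1%:R : R)^-1 ^+ q)).
  by rewrite addrK; apply: eq_bigr => j _; rewrite addn1.
apply: eq_bigr => j _; rewrite -exprMn -invfM -natrM; congr (_%:R^-1 ^+ _); lia.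
Qed.

Lemma beta_series_cvg (R : realType) (q : nat) : (2 <= q)%N ->
  cvgn (series (fun j => (- 1) ^+ j * ((2 * j + 1)%:R : R)^-1 ^+ q)).
Proof.
move=> q2; apply: normed_cvg.
apply: (@series_le_cvg R _ (fun j => (j.+1%:R : R)^-1 ^+ 2)); last exact: cvg_inv_pow.
- by move=> j; exact: normr_ge0.
- by move=> j; exact: inv_pow_ge0.
- move=> j /=; rewrite normrM normrX normrN1 expr1n mul1r ger0_norm ?inv_pow_ge0//.
  rewrite addn1; apply: le_trans (@inv_pow_le_sqr R q (2 * j) q2) _.
  rewrite lerXn2r ?nnegrE ?invr_ge0// lef_pV2 ?posrE ?ltr0n// ler_nat; lia.
Qed.

Lemma betaE (R : realType) (q : nat) :
  dirichlet_beta (q%:R : R) = limn (series (fun j => (- 1) ^+ j * ((2 * j + 1)%:R : R)^-1 ^+ q)).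
Proof.
rewrite /dirichlet_beta; congr (limn (series _)); apply/funext => j.
by rewrite powR_mulrn// exprVn.
Qed.

Lemma beta_cvg (R : realType) (q : nat) : (2 <= q)%N ->
  \sum_(j < n) ((- 1) ^+ j * ((2 * j + 1)%:R : R)^-1 ^+ q) @[n --> \oo] --> dirichlet_beta (q%:R : R).
Proof.
move=> q2; rewrite betaE.
rewrite (_ : (fun n => \sum_(j < n) _) = series (fun j => (- 1) ^+ j * ((2 * j + 1)%:R : R)^-1 ^+ q)).
  exact: beta_series_cvg.
by apply/funext => n; rewrite /series/= big_mkord.
Qed.

Lemma beta_pair_sum (R : realType) (q n : nat) :
  \sum_(j < 2 * n) ((- 1) ^+ j * ((2 * j + 1)%:R : R)^-1 ^+ q) =
  \sum_(j < n) (((4 * j + 1)%:R : R)^-1 ^+ q - ((4 * j + 3)%:R : R)^-1 ^+ q).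
Proof.
rewrite -(sum_even_odd (fun j => (- 1) ^+ j * ((2 * j + 1)%:R : R)^-1 ^+ q)).
apply: eq_bigr => j _.
rewrite exprD expr1 exprM sqrrN expr1n expr1n mul1r mul1r mulN1r.
by congr (_%:R^-1 ^+ _ - _%:R^-1 ^+ _); lia.
Qed.

(** Grouped two by two, the terms of the series are nonnegative, and the first group is
    [1 - 3^-q]. *)
Lemma beta_gt0 (R : realType) (q : nat) : (2 <= q)%N -> 0 < dirichlet_beta (q%:R : R).
Proof.
move=> q2; apply: (@lt_le_trans _ _ (1 - 3^-1 ^+ q)).
  by rewrite subr_gt0 exprn_ilt1 ?invr_ge0 ?invf_lt1//; lia || lra.
have h := cvgn_subseq (f := fun n => (2 * n)%N) (fun n => ltac:(lia)) (@beta_cvg R q q2).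
rewrite -(cvg_lim (@Rhausdorff R) h); apply: limr_ge; first exact: cvgP h.
exists 1%N => // n /= n1; case: n n1 => // n _.
rewrite beta_pair_sum big_ord_recl/= !muln0 !add0n invr1 expr1n lerDl.
apply: sumr_ge0 => j _; rewrite subr_ge0 lerXn2r ?nnegrE ?invr_ge0//.
by rewrite lef_pV2 ?posrE ?ltr0n ?ler_nat//; lia.
Qed.

Definition omega (R : realType) (l : nat) : R :=
  pi * (2 / pi) ^+ l.+1 *
  (if odd l then dirichlet_beta l.+1%:R else (1 - 2^-1 ^+ l.+1) * zeta l.+1%:R).

Lemma pole1E (R : realType) (j : nat) : (pole1 R j)^-1 = 2 / pi * (4 * j + 1)%:R^-1.
Proof.
have -> : pole1 R j = pi / 2 * (4 * j + 1)%:R by rewrite /pole1 natrD natrM; field.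
by rewrite invfM invf_div.
Qed.

Lemma pole3E (R : realType) (j : nat) : (pole3 R j)^-1 = 2 / pi * (4 * j + 3)%:R^-1.
Proof.
have -> : pole3 R j = pi / 2 * (4 * j + 3)%:R by rewrite /pole3 natrD natrM; field.
by rewrite invfM invf_div.
Qed.

(** The poles are [pi / 2] times [4j + 1] and [4j + 3], together all odd numbers. The sign [(-1)^l]
    on the second family makes the sum a beta series for odd [l] and the odd part of a zeta series
    for even [l]. *)
Lemma omega_sum_cvg (R : realType) (l : nat) : (0 < l)%N ->
  omega_sum R l N @[N --> \oo] --> omega R l.
Proof.
move=> l0; have l2 : (2 <= l.+1)%N by [].
have e2 n : (n <= 2 ^ n)%N by exact/ltnW/ltn_expl.
rewrite /omega; case: ifPn => ol.
  have h := cvgn_subseq (f := fun n => (2 * n)%N) (fun n => ltac:(lia)) (@beta_cvg R l.+1 l2).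
  have {}h := cvgn_subseq e2 h.
  rewrite (_ : omega_sum R l = fun N => pi * (2 / pi) ^+ l.+1 *
     \sum_(j < 2 * 2 ^ N) ((- 1) ^+ j * ((2 * j + 1)%:R : R)^-1 ^+ l.+1)).
    by apply: cvgMr.
  apply/funext => N; rewrite beta_pair_sum /omega_sum -mulrA; congr (_ * _); rewrite mulr_sumr.
  apply: eq_bigr => j _; rewrite pole1E pole3E !exprMn -[l in (-1) ^+ l]odd_double_half ol.
  by rewrite exprD expr1 -mul2n exprM sqrrN !expr1n; ring.
have h := cvgn_subseq (f := fun n => (2 * n)%N) (fun n => ltac:(lia)) (@odd_zeta_cvg R l.+1 l2).
have {}h := cvgn_subseq e2 h.
rewrite (_ : omega_sum R l = fun N => pi * (2 / pi) ^+ l.+1 *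
   \sum_(j < 2 * 2 ^ N) (((2 * j + 1)%:R : R)^-1 ^+ l.+1)).
  by apply: cvgMr.
apply/funext => N; rewrite -(sum_even_odd (fun j => ((2 * j + 1)%:R : R)^-1 ^+ l.+1)).
rewrite /omega_sum -mulrA; congr (_ * _); rewrite mulr_sumr.
apply: eq_bigr => j _; rewrite pole1E pole3E !exprMn.
rewrite -[l in (-1) ^+ l]odd_double_half (negbTE ol) add0n -mul2n exprM sqrrN !expr1n.
have -> : (2 * (2 * j) + 1 = 4 * j + 1)%N by lia.
have -> : (2 * (2 * j + 1) + 1 = 4 * j + 3)%N by lia.
by ring.
Qed.

(** * The integrals and their sign patterns *)

Lemma sinhD (R : realType) (x y : R) : sinh (x + y) = sinh x * cosh y + cosh x * sinh y.
Proof. by rewrite /sinh /cosh opprD !expRD; field. Qed.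

Lemma coshN (R : realType) (x : R) : cosh (- x) = cosh x.
Proof. by rewrite /cosh opprK addrC. Qed.

Lemma sinhN (R : realType) (x : R) : sinh (- x) = - sinh x.
Proof. by rewrite /sinh opprK; ring. Qed.

Lemma chebyshevU_cosh (R : realType) (m : nat) (x : R) :
  (chebyshevU R m).[cosh x] * sinh x = sinh (m.+1%:R * x).
Proof.
suff [] : (chebyshevU R m).[cosh x] * sinh x = sinh (m.+1%:R * x) /\
          (chebyshevU R m.+1).[cosh x] * sinh x = sinh (m.+2%:R * x) by [].
elim: m => [|m [IH1 IH2]].
  rewrite /chebyshevU /= -polyC1 hornerC hornerMn hornerX; split; first by rewrite !mul1r.
  have -> : 2%:R * x = x + x by ring.
  by rewrite sinhD; ring.
split=> //; rewrite chebyshevU_rec hornerD hornerN hornerM hornerMn hornerX mulrBl -mulrA IH2 IH1.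
have -> : m.+3%:R * x = m.+2%:R * x + x by rewrite -[in LHS]natr1; ring.
have -> : m.+1%:R * x = m.+2%:R * x + - x by rewrite -[in RHS]natr1; ring.
by rewrite !sinhD coshN sinhN; ring.
Qed.

Lemma size_chebyshevU (R : realType) (m : nat) : (size (chebyshevU R m) <= m.+1)%N.
Proof.
have hX : (size ('X *+ 2 : {poly R}) <= 2)%N.
  by rewrite -scaler_nat (leq_trans (size_scale_leq _ _))// size_polyX.
suff [] : (size (chebyshevU R m) <= m.+1)%N /\ (size (chebyshevU R m.+1) <= m.+2)%N by [].
elim: m => [|m [IH1 IH2]]; first by rewrite /chebyshevU /= size_poly1.
split=> //; rewrite chebyshevU_rec.
rewrite (leq_trans (size_polyD _ _))// geq_max size_polyN; apply/andP; split.
  apply: leq_trans (size_polyMleq _ _) _.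
  by move: hX IH2; move: (size _) (size _) => a b; lia.
by apply: leq_trans IH1 _; lia.
Qed.

(** [U_(2n-2)(cosh x) sinh x] is expanded in powers of [cosh x]; the power [i] turns [cosh^(r+1)]
    into [cosh^(r-i+1)], that is [m = r - i]. The bound [2n - 2 < r] keeps [m] positive. *)
Lemma has_int_sinh_cosh (R : realType) (tau : nat -> R) (n r : nat) :
  (forall m, (0 < m)%N -> has_int (tau_fun m) (tau m)) -> (1 <= n)%N -> (2 * n - 2 < r)%N ->
  has_int (fun x => sinh ((2 * n - 1)%:R * x) / (x * cosh x ^+ r.+1))
    (\sum_(1 <= m < r.+1) (chebyshevU R (2 * n - 2))`_(r - m) * tau m).
Proof.
move=> htau n1 nr; set U := chebyshevU R (2 * n - 2).
have : has_int (fun x => \sum_(1 <= m < r.+1) U`_(r - m) * tau_fun m x)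
    (\sum_(1 <= m < r.+1) U`_(r - m) * tau m).
  rewrite big_nat_cond; under eq_fun do rewrite big_nat_cond.
  by apply: has_int_sum => m /andP[/andP[m1 _] _]; apply/has_intZ/htau.
apply: has_int_ext => x x0; have c0 := cosh_gt0 x.
have -> : (2 * n - 1 = (2 * n - 2).+1)%N by lia.
rewrite -chebyshevU_cosh -/U.
rewrite (@horner_coef_wide _ r); last by rewrite (leq_trans (size_chebyshevU _ _)).
rewrite big_add1 /= big_mkord (reindex_inj rev_ord_inj) /= !mulr_suml.
apply: eq_bigr => i _.
have -> : (r - (r - i.+1).+1 = i)%N by have := ltn_ord i; lia.
rewrite /tau_fun.
have -> : cosh x ^+ r.+1 = cosh x ^+ i * cosh x ^+ (r - i.+1).+2.
  by rewrite -exprD; congr (_ ^+ _); have := ltn_ord i; lia.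
by field; rewrite !expf_neq0 ?lt0r_neq0.
Qed.

Definition Uasin_expr (R : realType) (n k : nat) : asin_expr R :=
  AMul (ACosPow (2 * n - 1)%:R ((1 - (2 * n - 1)%:R) * (pi / 2)) k) AInvCos.

Lemma aeval_Uasin (R : realType) (n k : nat) (z : R) : (1 <= n)%N -> -1 < z < 1 ->
  aeval (Uasin_expr R n k) z = (chebyshevU R (2 * n - 2)).[z] * asin z ^+ k.
Proof. by move=> n1 z1; rewrite /= aeval_APow chebyshevU_asin//; ring. Qed.

Lemma coef_ataylor_Uasin (R : realType) (n r k M : nat) : (1 <= n)%N -> (r < M)%N ->
  (ataylor (Uasin_expr R n k) M)`_r = coefUasin R n r k.
Proof.
move=> n1 rM; rewrite coef_poly rM /coefUasin /coef_at0.
rewrite (@derive1n_aeval _ _ (Uasin_expr R n k))//.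
  by move=> z z1; rewrite aeval_Uasin.
by rewrite ltrN10 ltr01.
Qed.

(** Both sides are coefficients of [z^r]: on the left in [U T], where [T] collects the [tau m z^m],
    on the right in the Taylor polynomial [W] of [U(z)] times the sum of the [omega l (arcsin z)^l].
    [T] and that sum approximate the same integral, so [U T - W] is [O(z^(r+1))]. *)
Lemma tau_omega (R : realType) (tau : nat -> R) (n r : nat) :
  (forall m, (0 < m)%N -> has_int (tau_fun m) (tau m)) -> (1 <= n)%N ->
  \sum_(1 <= m < r.+1) (chebyshevU R (2 * n - 2))`_(r - m) * tau m =
  \sum_(1 <= l < r.+1) omega R l * coefUasin R n r l.
Proof.
move=> htau n1; set U := chebyshevU R (2 * n - 2).
pose T : {poly R} := \sum_(1 <= m < r.+1) tau m *: 'X^m.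
pose e l := Uasin_expr R n l.
pose W : {poly R} := \sum_(1 <= l < r.+1) omega R l *: ataylor (e l) r.+1.
have TE : (U * T)`_r = \sum_(1 <= m < r.+1) U`_(r - m) * tau m.
  rewrite /T mulr_sumr coef_sum; apply: eq_big_nat => m /andP[_ mr].
  by rewrite -scalerAr coefZ coefMXn ltnNge -ltnS mr/= mulrC.
have WE : W`_r = \sum_(1 <= l < r.+1) omega R l * coefUasin R n r l.
  rewrite /W coef_sum; apply: eq_bigr => l _.
  by rewrite coefZ coef_ataylor_Uasin.
rewrite -TE -WE; apply/eqP; rewrite -subr_eq0 -coefB; apply/eqP.
have [Cl hCl] : {Cl : nat -> R & forall l, 0 <= Cl l /\ forall z : R, 0 <= z <= 1 / 2 ->
    `|aeval (e l) z - (ataylor (e l) r.+1).[z]| <= Cl l * z ^+ r.+1}.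
  apply: (@choice _ _ (fun l C => 0 <= C /\ forall z : R, 0 <= z <= 1 / 2 ->
    `|aeval (e l) z - (ataylor (e l) r.+1).[z]| <= C * z ^+ r.+1)) => l.
  by have [C C0 hC] := aeval_ataylor (e l) r.+1; exists C.
have [B B0 hB] := aeval_bounded (e 0%N).
(* [B] bounds [U], the parenthesis adds the two remainders of the integral, and the last sum the
   Taylor remainders. *)
pose K := B * (2 * tau r.+1 + 6 * pi * 3 ^+ r.+1) + \sum_(1 <= l < r.+1) `|omega R l| * Cl l.
apply: (@coef_eq0_of_small R r.+1 K) => // eps eps0.
have pi2 := pi_ge2 R.
pose s := Num.min (1 / 3) (eps / 2).
have s0 : 0 < s by rewrite lt_min !divr_gt0.
have s1 : s <= 1 / 3 by rewrite ge_min lexx.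
have se : s < eps by rewrite gt_min; apply/orP; right; lra.
pose z := sin s.
have zs : z <= s := sin_le_id (ltW s0).
(* Turns the remainder in [s] into one in [z = sin s]; source of [3 ^+ r.+1] in [K]. *)
have sz : s <= 3 * z.
  have := sin_ge_taylor (ltW s0); rewrite -/z.
  have : 0 <= s * (1 - s ^+ 2) by rewrite mulr_ge0 ?(ltW s0)//; nra.
  by rewrite mulrBr mulr1 -exprS; lra.
have z0 : 0 < z by lra.
have z12 : 0 <= z <= 1 / 2 by apply/andP; split; lra.
have z1 : -1 < z < 1 by apply/andP; split; lra.
have asz : asin z = s by rewrite /z sinK// in_itv/=; apply/andP; split; lra.
exists z; split=> //; first exact: le_lt_trans zs se.
have [A hA cA] : exists2 A : R, has_int (kern_diff s) A & int_sum s N @[N --> \oo] --> A.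
  by apply: kern_diff_int; apply/andP; split; lra.
have s13 : 0 < s <= 1 / 3 by rewrite s0.
have hT := kern_diff_tau r htau s13 hA.
have hO := int_sum_omega r (@omega_sum_cvg R) s13 cA.
rewrite -/z in hT.
pose Sz := \sum_(1 <= m < r.+1) tau m * z ^+ m.
pose Ss := \sum_(1 <= l < r.+1) omega R l * s ^+ l.
have Tz : T.[z] = Sz.
  by rewrite horner_sum; apply: eq_bigr => m _; rewrite hornerZ hornerXn.
have Uz : aeval (e 0%N) z = U.[z] by rewrite aeval_Uasin// expr0 mulr1.
have Wz : `|U.[z] * Ss - W.[z]| <= (\sum_(1 <= l < r.+1) `|omega R l| * Cl l) * z ^+ r.+1.
  rewrite /Ss /W horner_sum mulr_sumr -sumrB mulr_suml.
  apply: le_trans (ler_norm_sum _ _ _) _; apply: ler_sum => l _.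
  have -> : U.[z] * (omega R l * s ^+ l) - (omega R l *: ataylor (e l) r.+1).[z] =
      omega R l * (aeval (e l) z - (ataylor (e l) r.+1).[z]).
    by rewrite hornerZ aeval_Uasin// asz; ring.
  by rewrite normrM -mulrA ler_wpM2l//; case: (hCl l) => _; apply.
have SS : `|Sz - Ss| <= (2 * tau r.+1 + 6 * pi * 3 ^+ r.+1) * z ^+ r.+1.
  have h3 : s ^+ r.+1 <= 3 ^+ r.+1 * z ^+ r.+1.
    by rewrite -exprMn lerXn2r// nnegrE ?mulr_ge0 ?ltW.
  have h4 : 6 * pi * s ^+ r.+1 <= 6 * pi * (3 ^+ r.+1 * z ^+ r.+1).
    by rewrite ler_wpM2l// mulr_ge0// pi_ge0.
  (* Here the common integral [A] drops out. *)
  have -> : Sz - Ss = (A - Ss) - (A - Sz) by ring.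
  apply: le_trans (ler_normB _ _) _.
  apply: le_trans (lerD hO hT) _.
  move: h4; move: (s ^+ _) (z ^+ _) (3 ^+ _) => a b c; lra.
have -> : (U * T - W).[z] = U.[z] * (Sz - Ss) + (U.[z] * Ss - W.[z]).
  by rewrite hornerD hornerN hornerM Tz; ring.
apply: le_trans (ler_normD _ _) _.
rewrite /K mulrDl lerD// normrM -mulrA ler_pM//.
by rewrite -Uz hB.
Qed.

Lemma sum_even_support (V : zmodType) (F : nat -> V) (n : nat) :
  (forall l, odd l -> F l = 0) ->
  \sum_(1 <= l < (2 * n).+1) F l = \sum_(1 <= p < n.+1) F (2 * p)%N.
Proof.
move=> F0; elim: n => [|n IH]; first by rewrite !big_geq.
rewrite [in RHS]big_nat_recr//= -IH (_ : 2 * n.+1 = (2 * n).+2)%N; last by lia.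
rewrite [in LHS]big_nat_recr//= [in LHS]big_nat_recr//= [F (2 * n).+1]F0 ?addr0//.
by rewrite /= mul2n odd_double.
Qed.

Lemma sum_odd_support (V : zmodType) (F : nat -> V) (n : nat) :
  (forall l, ~~ odd l -> F l = 0) ->
  \sum_(1 <= l < (2 * n).+1) F l = \sum_(1 <= p < n.+1) F (2 * p - 1)%N.
Proof.
move=> F0; elim: n => [|n IH]; first by rewrite !big_geq.
rewrite [in RHS]big_nat_recr//= -IH (_ : 2 * n.+1 = (2 * n).+2)%N; last by lia.
rewrite [in LHS]big_nat_recr//= [in LHS]big_nat_recr//= [F (2 * n).+2]F0 ?addr0 ?subn1//.
by rewrite /= negbK mul2n odd_double.
Qed.

Lemma zeta_summandE (R : realType) (n p : nat) : 
  zeta_summand R n p = omega R (2 * p) * coefUasin R n (2 * n) (2 * p).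
Proof.
rewrite /zeta_summand /omega mul2n odd_double -mul2n addn1 exprMn !exprVn.
rewrite [pi ^+ _.+1]exprS.
have : pi != 0 :> R by rewrite lt0r_neq0 ?pi_gt0.
move: (@pi R) => q q0.
by field; rewrite q0 !expf_neq0.
Qed.

Lemma beta_summandE (R : realType) (n p : nat) : (1 <= p)%N ->
  beta_summand R n p = omega R (2 * p - 1) * coefUasin R n (2 * n - 1) (2 * p - 1).
Proof.
move=> p1; rewrite /beta_summand /omega.
have -> : odd (2 * p - 1) by lia.
have e : ((2 * p - 1).+1 = 2 * p)%N by lia.
rewrite e exprMn -[in pi^-1 ^+ _]e exprVn [pi ^+ _.+1]exprS.
have : pi != 0 :> R by rewrite lt0r_neq0 ?pi_gt0.
move: (@pi R) => q q0.
by field; rewrite q0 !expf_neq0.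
Qed.

Lemma omega_gt0 (R : realType) (l : nat) : (0 < l)%N -> 0 < omega R l.
Proof.
move=> l0; have pi0 := pi_gt0 R; rewrite /omega mulr_gt0//.
  by rewrite mulr_gt0// exprn_gt0// divr_gt0.
case: ifP => _; first exact: beta_gt0.
rewrite mulr_gt0 ?zeta_gt0// subr_gt0 exprn_ilt1 ?invr_ge0 ?invf_lt1//; lra.
Qed.

Lemma alternates_of_sign (R : realType) (n : nat) (t : nat -> R) : (1 <= n)%N ->
  (forall p, (1 <= p <= n)%N -> 0 < (- 1) ^+ (p - 1) * t p) -> alternates_from_pos n t.
Proof.
move=> n1 ht; split.
  by have := ht 1%N n1; rewrite subnn expr0 mul1r.
move=> p /andP[p1 pn].
have h1 : 0 < (- 1) ^+ (p - 1) * t p by apply: ht; lia.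
have h2 : 0 < (- 1) ^+ (p.+1 - 1) * t p.+1 by apply: ht; lia.
have := mulr_gt0 h1 h2.
have -> : (p.+1 - 1 = (p - 1).+1)%N by lia.
have <- : - (((- 1) ^+ (p - 1)) ^+ 2 * (t p * t p.+1)) =
  (- 1) ^+ (p - 1) * t p * ((- 1) ^+ (p - 1).+1 * t p.+1).
  by rewrite [(- 1) ^+ (p - 1).+1]exprS; move: ((- 1) ^+ (p - 1)) (t p) (t p.+1) => a b c; ring.
by rewrite sqrr_sign mul1r oppr_gt0.
Qed.

Theorem proposition2p1 (R : realType) (n : nat) (hn : (1 <= n)%N) :
  [/\ (\int[lebesgue_measure]_(x in `]0%R, +oo[%classic)
         (sinh ((2 * n - 1)%:R * x) / (x * cosh x ^+ (2 * n + 1)))%:E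
       = (\sum_(1 <= p < n.+1) zeta_summand R n p)%:E)%E,
      (\int[lebesgue_measure]_(x in `]0%R, +oo[%classic)
         (sinh ((2 * n - 1)%:R * x) / (x * cosh x ^+ (2 * n)))%:E
       = (\sum_(1 <= p < n.+1) beta_summand R n p)%:E)%E,
      forall p : nat, (1 <= p <= n)%N ->
        0 < (-1) ^+ (p - 1) * coefUasin R n (2 * n) (2 * p) /\
        0 < (-1) ^+ (p - 1) * coefUasin R n (2 * n - 1) (2 * p - 1),
      alternates_from_pos n (zeta_summand R n)
    & alternates_from_pos n (beta_summand R n)].
Proof.
(* One sequence must serve both formulas; [tau 0] is a dummy value. *)
have [tau htau] : {tau : nat -> R & forall m, (0 < m)%N -> has_int (tau_fun m) (tau m)}.
  apply: (@choice _ _ (fun m v => (0 < m)%N -> has_int (tau_fun m) v)) => m.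
  by case: (posnP m) => [->|m0]; [exists 0|have [v hv] := has_int_tau_fun R m0; exists v].
have zpos p : (1 <= p <= n)%N -> 0 < (- 1) ^+ (p - 1) * zeta_summand R n p.
  move=> pn; rewrite zeta_summandE mulrCA mulr_gt0 ?coefUasin_even_gt0 ?omega_gt0//; lia.
have bpos p : (1 <= p <= n)%N -> 0 < (- 1) ^+ (p - 1) * beta_summand R n p.
  move=> pn; rewrite beta_summandE; last by lia.
  rewrite mulrCA mulr_gt0 ?coefUasin_odd_gt0 ?omega_gt0//; lia.
split.
- have [_] := has_int_sinh_cosh (n := n) (r := 2 * n) htau hn ltac:(lia).
  rewrite tau_omega// sum_even_support; last first.
    by move=> l ol; rewrite coefUasin_parity ?mulr0// oddD mul2n odd_double.
  rewrite addn1 => ->; congr EFin; apply: eq_bigr => p _.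
  by rewrite zeta_summandE.
- have [_] := has_int_sinh_cosh (n := n) (r := 2 * n - 1) htau hn ltac:(lia).
  rewrite tau_omega//.
  pose F l := omega R l * coefUasin R n (2 * n - 1) l.
  have F0 l : ~~ odd l -> F l = 0.
    by move=> ol; rewrite /F coefUasin_parity ?mulr0//; lia.
  (* The range is extended by [l = 2n], an even index where [F] vanishes, to fit
     [sum_odd_support]. *)
  have -> : \sum_(1 <= l < (2 * n - 1).+1) F l = \sum_(1 <= p < n.+1) F (2 * p - 1)%N.
    rewrite -sum_odd_support// (_ : (2 * n - 1).+1 = 2 * n)%N; last by lia.
    by rewrite [RHS]big_nat_recr/= ?F0 ?addr0//; lia.
  rewrite (_ : (2 * n - 1).+1 = 2 * n)%N; last by lia.
  move=> ->; congr EFin; apply: eq_big_nat => p /andP[p1 _].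
  by rewrite beta_summandE.
- by move=> p pn; split; [exact: coefUasin_even_gt0|exact: coefUasin_odd_gt0].
- exact: alternates_of_sign.
- exact: alternates_of_sign.
Qed.
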